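(* Every bridgeless graph containing no 5-edge-cuts and at most three 3-edge-cuts admits a nowhere-zero 3-flow.
   Context: Graphs are finite and loopless, but may have multiple edges. For $X\subset V(G)$, $\partial_G(X)$ denotes the set of edges of $G$ with one end in $X$ and the other in $V(G)\setminus X$; an edge set of the form $C=\partial_G(X)$ is a $k$-edge-cut if $|C|=k$. Edge-cuts are counted as edge sets. For an orientation $D$ of $E(G)$ and a vertex $v$, $\partial_D^+(v)$ (resp. $\partial_D^-(v)$) is the set of arcs with tail (resp. head) $v$. A graph $G$ admits a nowhere-zero 3-flow if there are an orientation $D$ of $E(G)$ and a function $f:E(G)\to\{\pm1,\pm2\}$ such that $\sum_{e\in\partial_D^+(v)}f(e)=\sum_{e\in\partial_D^-(v)}f(e)$ for every $v\in V(G)$. *)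

(* Defs.v *)
From mathcomp Require Import all_boot all_order all_algebra.

Set Implicit Arguments.
Unset Strict Implicit.
Unset Printing Implicit Defensive.

Import Order.TTheory GRing.Theory Num.Theory.

(* Finite loopless multigraphs: distinct edges may have the same pair of ends,
   and loops are excluded because every edge has exactly two ends. *)
Record mgraph := MGraph {
  vertex : finType;
  edge : finType;
  ends : edge -> {set vertex};
  card_ends : forall e, #|ends e| = 2
}.

Section Graph.

Variable G : mgraph.

Definition cut (X : {set vertex G}) : {set edge G} :=
  [set e | [exists u in X, exists v in ~: X, ends e == [set u; v]]].

(* A set of edge sets: a cut given by several X (such as X and ~: X) is counted
   once. *)
Definition edge_cuts (k : nat) : {set {set edge G}} :=
  [set C in [set cut X | X : {set vertex G}] | #|C| == k].

(* Adjacency in G - e. *)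
Definition adj_minus (e : edge G) : rel (vertex G) :=
  [rel u v | [exists f, (f != e) && (ends f == [set u; v])]].

(* A bridge is an edge whose ends lie in different components of G - e. *)
Definition bridge (e : edge G) : bool :=
  [exists u, exists v,
     (ends e == [set u; v]) && ~~ connect (adj_minus e) u v].

Definition bridgeless : Prop := forall e : edge G, ~~ bridge e.

(* D e = (tail of e, head of e). *)
Definition orientation (D : edge G -> vertex G * vertex G) : Prop :=
  forall e, ends e = [set (D e).1; (D e).2].

Definition out_arcs (D : edge G -> vertex G * vertex G) (v : vertex G) :
  {set edge G} := [set e | (D e).1 == v].

Definition in_arcs (D : edge G -> vertex G * vertex G) (v : vertex G) :
  {set edge G} := [set e | (D e).2 == v].

Definition nowhere_zero_3flow : Prop :=
  exists (D : edge G -> vertex G * vertex G) (f : edge G -> int),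
    [/\ orientation D,
        forall e, f e \in [:: 1; -1; 2; -2]%R &
        forall v, (\sum_(e in out_arcs D v) f e =
                   \sum_(e in in_arcs D v) f e)%R].

Lemma adj_minus_sym e : symmetric (adj_minus e).
Proof. by move=> u v /=; apply: eq_existsb => f; rewrite setUC. Qed.

(* Bridges are exactly the edges forming 1-edge-cuts. *)
Lemma bridgeE (e : edge G) : bridge e = ([set e] \in edge_cuts 1).
Proof.
apply/idP/idP.
  case/existsP=> u /existsP[v /andP[/eqP Ee nuv]].
  rewrite inE cards1 eqxx andbT; apply/imsetP.
  exists [set w | connect (adj_minus e) u w] => //.
  apply/setP=> f; rewrite !inE; apply/eqP/existsP.
    move=> ->; exists u; rewrite inE connect0 /=.
    by apply/existsP; exists v; rewrite !inE nuv Ee eqxx.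
  case=> a /andP[]; rewrite inE => ua /existsP[b /andP[]].
  rewrite !inE => nub /eqP Ef; apply/eqP/negPn/negP=> nfe.
  case/negP: nub; apply: connect_trans ua (connect1 _).
  by apply/existsP; exists f; rewrite nfe Ef eqxx.
rewrite inE => /andP[/imsetP[X _ EX] _].
have: e \in cut X by rewrite -EX set11.
rewrite inE => /existsP[u /andP[uX /existsP[v /andP[]]]].
rewrite inE => vX Ee; apply/existsP; exists u; apply/existsP; exists v.
rewrite Ee /=; apply/negP=> uv; case/negP: vX.
have clX : closed (adj_minus e) (mem X).
  apply: intro_closed => [|a b /existsP[f /andP[nfe Ef]] aX].
    exact: sym_connect_sym (@adj_minus_sym e).
  apply/negPn/negP=> nbX; case/negP: nfe; rewrite -in_set1 EX inE.
  apply/existsP; exists a; rewrite aX /=.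
  by apply/existsP; exists b; rewrite inE nbX.
by rewrite -(closed_connect clX uv).
Qed.

End Graph.

(* Main.v *)
Require Import Defs.
From mathcomp Require Import all_boot all_order all_algebra.
From mathcomp Require Import zify ring.

Set Implicit Arguments.
Unset Strict Implicit.
Unset Printing Implicit Defensive.

Import Order.TTheory GRing.Theory Num.Theory.

Local Open Scope ring_scope.

(** A nowhere-zero 3-flow is, modulo 3, a choice of a sign for each edge, the
    edges being directed arbitrarily, such that the net outflow of every vertex
    is divisible by 3 ([flow3]).  Such signs can be made integral
    ([integral_flow]): shifting values by 3 along a path from a vertex of
    positive net outflow to one of negative net outflow lowers the total
    imbalance, and if no negative vertex is reachable, then every edge leaving
    the reachable set carries a negative value outwards, which contradicts the
    positive outflow of that set.

    The core is a theorem of Lovasz, Thomassen, Wu and Zhang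
    ([flow_of_admissible]).  Every vertex v has a weight T v, which matters
    modulo 6: modulo 3 it is the prescribed net outflow, and its parity is that
    of the degree.  Let |t| be the distance from t to the multiples of 6.  The
    edges at a root z are already directed, z has degree at most 4 + |T z|, and
    every nonempty proper subset A of the other vertices has at least 4 + |T(A)|
    boundary edges; one vertex of weight 0 is exempt.  Then the directions at z
    extend to the graph.  In a smallest counterexample such a set A of at least
    two vertices has two boundary edges to spare: otherwise contract A, direct
    the contracted graph, and take the complement of A as a new root
    ([flow_slack]).  With this slack a vertex of weight 0 can be lifted off pair
    by pair ([flow_zero]).  All other weights then have a sign modulo 6
    (3 has both), and directing an edge from a positive vertex to a negative one
    and deleting it is harmless ([flow_delete]).  The graph without z is connected in a strong sense
    ([exit_edge]), so one may assume that all weights are positive, and that all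
    edges at z leave z; hence z has degree at most 5.  Now an edge yx can be
    traded for an arc zx if z has degree at most 4, and two edges zx and yx for
    two arcs xz if z has degree 5 ([flow_positive]).

    For flows all prescribed outflows are 0, so |T(A)| is 0 for an even cut and
    3 for an odd one: even cuts must have size at least 4, odd cuts at least 7.
    Up to three vertices of degree 3 may violate this.  Each of them is a source
    or a sink, and all of them together form the root ([merge_flow]).  If two of
    them are adjacent, the root is small enough ([few_cubic_adjacent]).
    Otherwise its degree 6 or 9 exceeds the bound by exactly 2, and one deletes
    an edge at a source and an edge at a sink ([merge_deleted]).  This only
    hurts neighbours of degree 4, but a vertex of degree 4 can be split off
    beforehand: this creates no bridge as soon as every 3-edge-cut is trivial
    ([few_cubic_split]).

    A given graph without 5-edge-cuts is brought to this form by contractions,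
    which create no new cuts ([thin_flow3]).  The two ends of an edge of a
    2-edge-cut are identified, since the flow on that edge is forced by the
    other one.  For a nontrivial 3-edge-cut both sides are contracted: modulo 3
    the three edges of the cut must all point to the same side, so the two flows
    agree on them up to a global sign ([flow3_cut3]). *)

(** * Cuts and signed sums over edges *)

(** Function update, used to redirect, delete or re-sign a single edge. *)
Definition upd (A : eqType) (B : Type) (f : A -> B) (a : A) (b : B) : A -> B :=
  fun x => if x == a then b else f x.

(** The distance from [n] to the nearest multiple of 6; the residue is taken in
    the window from -3 to 2. *)
Definition dist6 (n : int) : nat := absz (((n + 3) %% 6)%Z - 3).

Section Cuts.

Variables E V : finType.
Implicit Types (h : E -> V * V) (A B S : {set V}) (p : V * V).
Implicit Types (g : E -> int) (T : V -> int).

Definition crossing A p : bool := (p.1 \in A) != (p.2 \in A).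
Definition deg h A : nat := \sum_e crossing A (h e).

(** The coefficient of the edge in the net outflow of [A]: 1 for an edge leaving
    [A], -1 for an edge entering it. *)
Definition incid A p : int := (p.1 \in A)%:Z - (p.2 \in A)%:Z.
Definition net h g A : int := \sum_e g e * incid A (h e).

Definition wt T A : int := \sum_(v in A) T v.
Definition bump T x (c : int) : V -> int := fun u => T u + c * (u == x)%:Z.

(** Edges that count for the induction: a loop is a deleted edge, and edges at
    the root are already directed. *)
Definition off_root (z : V) p : bool := [&& p.1 != p.2, p.1 != z & p.2 != z].
Definition edges_off_root h z : nat := \sum_e off_root z (h e).

(** [S] is the set of vertices of the graph; the type [V] is kept fixed while
    contractions shrink [S]. *)
Definition within h S : Prop := forall e, (h e).1 \in S /\ (h e).2 \in S.
Definition sign g : Prop := forall e, g e = 1 \/ g e = -1.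

Definition joins p x y : bool := (p == (x, y)) || (p == (y, x)).
(** The sign that directs the edge [p] away from its end [x]. *)
Definition leaving p x : int := if p.1 == x then 1 else -1.

Lemma upd_eq (C : eqType) (D : Type) (f : C -> D) a b : upd f a b a = b.
Proof. by rewrite /upd eqxx. Qed.

Lemma upd_neq (C : eqType) (D : Type) (f : C -> D) a b x : x != a -> upd f a b x = f x.
Proof. by rewrite /upd => /negPf ->. Qed.

Lemma deg_upd h e p A :
  (deg (upd h e p) A + crossing A (h e) = deg h A + crossing A p)%N.
Proof.
rewrite /deg (bigD1 e) //= [in RHS](bigD1 e) //= upd_eq.
rewrite (eq_bigr (fun i => crossing A (h i) : nat)); first lia.
by move=> i ie; rewrite upd_neq.
Qed.

Lemma edges_off_root_upd h e p z :
  (edges_off_root (upd h e p) z + off_root z (h e) = edges_off_root h z + off_root z p)%N.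
Proof.
rewrite /edges_off_root (bigD1 e) //= [in RHS](bigD1 e) //= upd_eq.
rewrite (eq_bigr (fun i => off_root z (h i) : nat)); first lia.
by move=> i ie; rewrite upd_neq.
Qed.

Lemma net_upd h e p g A :
  net (upd h e p) g A = net h g A + g e * (incid A p - incid A (h e)).
Proof.
rewrite /net (bigD1 e) //= [in RHS](bigD1 e) //= upd_eq.
rewrite (eq_bigr (fun i => g i * incid A (h i))); first ring.
by move=> i ie; rewrite upd_neq.
Qed.

Lemma net_updg h g e c A :
  net h (upd g e c) A = net h g A + (c - g e) * incid A (h e).
Proof.
rewrite /net (bigD1 e) //= [in RHS](bigD1 e) //= upd_eq.
rewrite (eq_bigr (fun i => g i * incid A (h i))); first ring.
by move=> i ie; rewrite upd_neq.
Qed.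

Lemma netN h g A : net h (fun e => - g e) A = - net h g A.
Proof. by rewrite /net -sumrN; apply: eq_bigr => e _; rewrite mulNr. Qed.

Lemma wt_bump T x c A : wt (bump T x c) A = wt T A + c * (x \in A)%:Z.
Proof.
rewrite /wt /bump big_split /= -mulr_sumr; congr (_ + c * _).
case: (boolP (x \in A)) => xA.
  rewrite (bigD1 x) //= eqxx big1 ?addr0 // => i /andP[_ /negPf ->] //.
by rewrite big1 // => i iA; case: eqP => // ix; rewrite -ix iA in xA.
Qed.

Lemma wtN T A : wt (fun v => - T v) A = - wt T A.
Proof. by rewrite /wt -sumrN. Qed.

Lemma wt1 T v : wt T [set v] = T v.
Proof. by rewrite /wt big_set1. Qed.

Lemma wtD T A S : A \subset S -> wt T (S :\: A) = wt T S - wt T A.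
Proof. by move=> AS; rewrite /wt (big_setID A (A := S)) /= (setIidPr AS) addrC addrK. Qed.

Lemma wtU T A B : [disjoint A & B] -> wt T (A :|: B) = wt T A + wt T B.
Proof.
move=> AB; have := wtD T (subsetUl A B).
have -> : (A :|: B) :\: A = B by rewrite setDUl setDv set0U; apply/setDidPl; rewrite disjoint_sym.
by move=> ->; lia.
Qed.

Lemma incid_sum A p : incid A p = \sum_(v in A) incid [set v] p.
Proof.
have ind (x : V) : (x \in A)%:Z = \sum_(v in A) (x == v)%:Z.
  case: (boolP (x \in A)) => xA.
    by rewrite (bigD1 x) //= eqxx big1 ?addr0 // => i /andP[_]; rewrite eq_sym => /negPf ->.
  by rewrite big1 // => i iA; case: eqP => // xi; rewrite xi iA in xA.
rewrite /incid !ind -sumrB; apply: eq_bigr => v _.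
by rewrite !inE.
Qed.

Lemma net_sum h g A : net h g A = \sum_(v in A) net h g [set v].
Proof.
rewrite /net exchange_big /=; apply: eq_bigr => e _.
by rewrite incid_sum mulr_sumr.
Qed.

(** A sum of signs over the boundary has the parity of its number of terms.  This
    yields all parities of degrees and weights below. *)
Lemma net_parity h g A : sign g -> (2 %| net h g A - (deg h A)%:Z)%Z.
Proof.
move=> sg; rewrite /net /deg (big_morph Posz PoszD (erefl _)) -sumrB.
apply: (big_ind (fun x => 2 %| x)%Z) => // [x y|e _]; first lia.
by rewrite /incid /crossing; case: (sg e) => ->; do 2!case: (_ \in A).
Qed.

Lemma crossingD h S A e : within h S -> A \subset S ->
  crossing (S :\: A) (h e) = crossing A (h e).
Proof.
move=> wf AS; have [s1 s2] := wf e.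
by rewrite /crossing !inE s1 s2 !andbT; do 2!case: (_ \in A).
Qed.

Lemma degD h S A : within h S -> A \subset S -> deg h (S :\: A) = deg h A.
Proof. by move=> wf AS; apply: eq_bigr => e _; rewrite (crossingD _ wf). Qed.

Lemma netD h S A g : within h S -> A \subset S -> net h g (S :\: A) = - net h g A.
Proof.
move=> wf AS; rewrite /net -sumrN; apply: eq_bigr => e _.
have [s1 s2] := wf e; rewrite /incid !inE s1 s2 !andbT.
by do 2!case: (_ \in A); lia.
Qed.

Lemma within_upd h S e p : within h S -> p.1 \in S -> p.2 \in S -> within (upd h e p) S.
Proof. by move=> wf p1 p2 f; rewrite /upd; case: eqP. Qed.

Lemma joins_incid p x y A : x != y -> joins p x y ->
  incid A p = leaving p x * ((x \in A)%:Z - (y \in A)%:Z).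
Proof.
move=> xy; rewrite /joins /incid /leaving => /orP[] /eqP -> /=.
  by rewrite eqxx; lia.
by rewrite eq_sym (negPf xy); lia.
Qed.

Lemma joins_crossing p x y A : joins p x y ->
  crossing A p = ((x \in A) != (y \in A)).
Proof. by rewrite /joins /crossing => /orP[] /eqP -> //=; rewrite eq_sym. Qed.

Lemma joins_off_root p x y z : joins p x y -> off_root z p = [&& x != y, x != z & y != z].
Proof.
rewrite /joins /off_root => /orP[] /eqP -> //=.
by rewrite eq_sym [X in _ && X]andbC.
Qed.

Lemma leaving_sign p x : leaving p x = 1 \/ leaving p x = -1.
Proof. by rewrite /leaving; case: ifP; [left|right]. Qed.

Lemma leavingC p x y : x != y -> joins p x y -> leaving p y = - leaving p x.
Proof.
rewrite /leaving /joins => xy /orP[] /eqP -> /=.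
  by rewrite eqxx (negPf xy).
by rewrite eqxx eq_sym (negPf xy).
Qed.

Lemma joinsC p x y : joins p x y = joins p y x.
Proof. by rewrite /joins orbC. Qed.

Definition extends h S T z g0 g : Prop :=
  [/\ sign g, {in S, forall v, (3 %| net h g [set v] - T v)%Z}
    & forall e, crossing [set z] (h e) -> g e = g0 e].
(** Directions with the outflows prescribed by [T], extending the directions
    [g0] at the root [z]. *)
Definition feasible h S T z g0 : Prop := exists g, extends h S T z g0 g.

Lemma feasibleN h S T z g0 :
  feasible h S (fun v => - T v) z (fun e => - g0 e) -> feasible h S T z g0.
Proof.
case=> g [sg gT gz]; exists (fun e => - g e); split.
- by move=> e; case: (sg e) => ->; [right | left].
- by move=> v vS; rewrite netN; have := gT v vS; lia.
- by move=> e /gz ->; rewrite opprK.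
Qed.

(** Deleting the edge [e] after directing it from [x] to [y]: the rest of the
    graph must supply one unit less at [x] and one more at [y]. *)
Lemma feasible_del h S T z g0 e x y : x != y -> joins (h e) x y ->
  (crossing [set z] (h e) -> g0 e = leaving (h e) x) ->
  feasible (upd h e (x, x)) S (bump (bump T x (-1)) y 1) z g0 ->
  feasible h S T z g0.
Proof.
move=> xy hxy g0e [g [sg gT gz]]; exists (upd g e (leaving (h e) x)); split.
- by move=> f; rewrite /upd; case: eqP => // _; exact: leaving_sign.
- move=> v vS; have := gT v vS; congr (is_true (_ %| _)%Z).
  rewrite net_updg net_upd /bump (joins_incid _ xy hxy) /incid /= !inE !(eq_sym v).
  by case: (leaving_sign (h e) x) => ->; ring.
- move=> f fz; rewrite /upd; case: eqP => [ef|/eqP ef]; first by rewrite ef g0e // -ef.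
  by rewrite gz // upd_neq.
Qed.

(** Replacing the path [x v y] by an edge [xy].  Whatever the direction of the new
    edge, the path is directed through [v], and so is balanced at [v]. *)
Lemma feasible_lift h S T z g0 e1 e2 v x y :
  e1 != e2 -> x != v -> y != v -> v != z -> y != z ->
  joins (h e1) x v -> joins (h e2) y v ->
  feasible (upd (upd h e1 (x, y)) e2 (y, y)) S T z (upd g0 e1 (leaving (h e1) x * g0 e1)) ->
  feasible h S T z g0.
Proof.
move=> e12 xv yv vz yz h1 h2 [g [sg gT gz]].
exists (upd (upd g e1 (leaving (h e1) x * g e1)) e2 (- leaving (h e2) y * g e1)).
have e21 : e2 != e1 by rewrite eq_sym.
split.
- move=> f; rewrite /upd; case: eqP => _.
    by case: (sg e1) => ->; case: (leaving_sign (h e2) y) => ->; [right|left|left|right].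
  case: eqP => // _.
  by case: (sg e1) => ->; case: (leaving_sign (h e1) x) => ->; [left|right|right|left].
- move=> u uS; have := gT u uS; congr (is_true (_ %| _)%Z).
  rewrite !net_updg !net_upd !(upd_neq _ _ e21) (joins_incid _ xv h1) (joins_incid _ yv h2) /incid /= !inE.
  by case: (leaving_sign (h e1) x) => ->; case: (leaving_sign (h e2) y) => ->;
    ring.
- move=> f fz; have f2 : f != e2.
    by apply: contraTneq fz => ->; rewrite (joins_crossing _ h2) !inE (negPf vz) (negPf yz).
  rewrite (upd_neq _ _ f2) {1}/upd; case: eqP => [f1|/eqP f1].
    rewrite f1 in fz f2 *.
    move: (gz e1); rewrite upd_eq (upd_neq _ _ f2) upd_eq => ->.
      by case: (leaving_sign (h e1) x) => ->; lia.
    move: fz; rewrite (joins_crossing _ h1) /crossing /= !inE (negPf vz) (negPf yz).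
    by case: (x == z).
  by rewrite gz !upd_neq.
Qed.

(** Directing [e] from [y] to [x] looks the same to [x] as an arc from the root. *)
Lemma feasible_move h S T z g0 e x y : x != y -> x != z -> y != z -> joins (h e) y x ->
  feasible (upd h e (z, x)) S (bump (bump T y (-1)) z 1) z (upd g0 e 1) ->
  feasible h S T z g0.
Proof.
move=> xy xz yz he [g [sg gT gz]]; exists (upd g e (leaving (h e) y)).
have yx : y != x by rewrite eq_sym.
split.
- by move=> f; rewrite /upd; case: eqP => // _; exact: leaving_sign.
- have ge : g e = 1.
    by move: (gz e); rewrite !upd_eq => -> //; rewrite /crossing !inE eqxx (negPf xz).
  move=> v vS; have := gT v vS; congr (is_true (_ %| _)%Z).
  rewrite net_updg net_upd /bump ge (joins_incid _ yx he) /incid /= !inE !(eq_sym v).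
  by case: (leaving_sign (h e) y) => ->; ring.
- move=> f fz; have fe : f != e.
    by apply: contraTneq fz => ->; rewrite (joins_crossing _ he) !inE (negPf xz) (negPf yz).
  by rewrite upd_neq // gz !upd_neq.
Qed.

(** The two arcs arriving at [x] contribute -2 to its net outflow, and the two arcs
    leaving it 2, so its weight rises by 4; at the root 1 becomes -2, and the weight
    falls by 3. *)
Lemma feasible_double h S T z g0 e f x y :
  x != y -> x != z -> y != z -> joins (h e) y x -> joins (h f) z x ->
  g0 f = leaving (h f) z ->
  feasible (upd h e (z, x)) S (bump (bump (bump T y (-1)) z (-3)) x 4) z
    (upd (upd g0 e (-1)) f (- g0 f)) ->
  feasible h S T z g0.
Proof.
move=> xy xz yz he hf g0f [g [sg gT gz]].
have yx : y != x by rewrite eq_sym.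
have zx : z != x by rewrite eq_sym.
have fe : f != e.
  apply/eqP=> ef; rewrite ef in hf; have := joins_crossing [set z] he.
  by rewrite (joins_crossing _ hf) !inE eqxx (negPf xz) (negPf yz).
have ef : e != f by rewrite eq_sym.
exists (upd (upd g e (leaving (h e) y)) f (leaving (h f) z)); split.
- by move=> d; rewrite /upd; do 2![case: eqP => // _; first exact: leaving_sign].
- have ge : g e = -1.
    by move: (gz e); rewrite upd_eq (upd_neq _ _ ef) upd_eq => -> //; rewrite /crossing !inE eqxx (negPf xz).
  have gf : g f = - leaving (h f) z.
    move: (gz f); rewrite upd_eq g0f => -> //.
    by rewrite (upd_neq _ _ fe) (joins_crossing _ hf) !inE eqxx (negPf xz).
  move=> v vS; have := gT v vS; congr (is_true (_ %| _)%Z).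
  rewrite !net_updg net_upd /bump !(upd_neq _ _ fe) ge gf (joins_incid _ yx he) (joins_incid _ zx hf) /incid /= !inE !(eq_sym v).
  by case: (leaving_sign (h e) y) => ->; case: (leaving_sign (h f) z) => ->; ring.
- move=> d dz; have de : d != e.
    by apply: contraTneq dz => ->; rewrite (joins_crossing _ he) !inE (negPf xz) (negPf yz).
  rewrite {1}/upd; case: eqP => [->|/eqP df]; first by rewrite g0f.
  by rewrite upd_neq // gz !upd_neq.
Qed.

End Cuts.

(** * Contracting a vertex set *)

Section Contraction.

Variables E V : finType.
Implicit Types (h : E -> V * V) (A B S : {set V}) (p : V * V) (phi : V -> V).
Implicit Types (g : E -> int) (T : V -> int).

Definition relabel phi h : E -> V * V := fun e => (phi (h e).1, phi (h e).2).
Definition push phi S T : V -> int := fun v => \sum_(u in S | phi u == v) T u.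
Definition pre phi S A : {set V} := [set u in S | phi u \in A].
(** Contraction of [A] to a representative [r]. *)
Definition collapse A r : V -> V := fun v => if v \in A then r else v.

Lemma crossing_relabel phi h S A e : within h S ->
  crossing A (relabel phi h e) = crossing (pre phi S A) (h e).
Proof. by move=> wf; have [s1 s2] := wf e; rewrite /crossing !inE s1 s2. Qed.

Lemma deg_relabel phi h S A : within h S ->
  deg (relabel phi h) A = deg h (pre phi S A).
Proof. by move=> wf; apply: eq_bigr => e _; rewrite (crossing_relabel _ _ _ wf). Qed.

Lemma net_relabel phi h S g A : within h S ->
  net (relabel phi h) g A = net h g (pre phi S A).
Proof.
move=> wf; apply: eq_bigr => e _; have [s1 s2] := wf e.
by rewrite /incid !inE s1 s2.
Qed.

Lemma wt_push phi S T A : wt (push phi S T) A = wt T (pre phi S A).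
Proof.
rewrite /wt [in RHS](partition_big phi (mem A)) /= => [|u]; last by rewrite inE => /andP[].
apply: eq_bigr => v vA; apply: eq_bigl => u; rewrite inE.
by case: eqP => [->|_]; rewrite ?andbF ?vA ?andbT.
Qed.

Lemma push1 phi S T v : push phi S T v = wt T (pre phi S [set v]).
Proof. by rewrite -wt_push wt1. Qed.

Lemma pre_sub phi S A : pre phi S A \subset S.
Proof. by apply/subsetP=> u; rewrite inE => /andP[]. Qed.

Lemma pre_imset phi S : pre phi S (phi @: S) = S.
Proof. by apply/setP=> u; rewrite inE; apply: andb_idr => uS; rewrite imset_f. Qed.

Lemma image_pre phi S A : A \subset phi @: S -> phi @: pre phi S A = A.
Proof.
move=> sA; apply/setP=> v; apply/imsetP/idP => [[u]|vA].
  by rewrite inE => /andP[_ uA] ->.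
have /imsetP[u uS vu] := subsetP sA v vA.
by exists u => //; rewrite inE uS -vu.
Qed.

Lemma within_relabel phi h S : within h S -> within (relabel phi h) (phi @: S).
Proof. by move=> wf e; have [s1 s2] := wf e; split; apply: imset_f. Qed.

Lemma edges_off_root_relabel phi h z : (edges_off_root (relabel phi h) (phi z) <= edges_off_root h z)%N.
Proof.
apply: leq_sum => e _; rewrite /off_root /=.
case: eqP => //= n1; case: eqP => //= n2; case: eqP => //= n3.
case: eqP => [e1|_]; first by rewrite e1 in n1.
case: eqP => [e1|_]; first by rewrite e1 in n2.
by case: eqP => [e1|_]; first by rewrite e1 in n3.
Qed.

Lemma pre_collapse1 S A r v : r \in A -> v \in S :\: A ->
  pre (collapse A r) S [set v] = [set v].
Proof.
move=> rA; rewrite inE => /andP[vA vS]; apply/setP=> u; rewrite !inE /collapse.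
case: (boolP (u \in A)) => uA; last by case: eqP => [->|]; rewrite ?vS ?andbF.
case: eqP => [rv|_]; first by rewrite -rv rA in vA.
by rewrite andbF; case: eqP => // uv; rewrite -uv uA in vA.
Qed.

Lemma pre_collapse S A r : A \subset S -> r \in A ->
  pre (collapse A r) S [set r] = A.
Proof.
move=> AS rA; apply/setP=> u; rewrite !inE /collapse.
case: (boolP (u \in A)) => uA; first by rewrite eqxx (subsetP AS).
by case: eqP => [ur|_]; rewrite ?andbF //; rewrite ur rA in uA.
Qed.

Lemma imset_collapse S A r : A \subset S -> r \in A ->
  collapse A r @: S = r |: (S :\: A).
Proof.
move=> AS rA; apply/setP=> v; rewrite !inE; apply/imsetP/idP.
  case=> u uS ->; rewrite /collapse; case: (boolP (u \in A)) => uA; first by rewrite eqxx.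
  by rewrite uA uS orbT.
case/orP=> [/eqP ->|/andP[vA vS]].
  by exists r; rewrite ?(subsetP AS) // /collapse rA.
by exists v => //; rewrite /collapse (negPf vA).
Qed.

Lemma card_collapse S A r : A \subset S -> r \in A -> (1 < #|A|)%N ->
  (#|collapse A r @: S| < #|S|)%N.
Proof.
move=> AS rA A1; rewrite imset_collapse // cardsU1 !inE rA /=.
by have := cardsID A S; rewrite (setIidPr AS); lia.
Qed.

(** A cut splits the problem in two: the graph with [A] contracted is directed
    first, and its directions on the boundary of [A] become the directions at the
    root when the complement of [A] is contracted. *)
Lemma feasible_glue h S T A r q z g0 : within h S -> A \subset S -> r \in A ->
  q \in S :\: A -> z \notin A ->
  feasible (relabel (collapse A r) h) (collapse A r @: S)
    (push (collapse A r) S T) z g0 ->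
  (forall g1, sign g1 -> (3 %| net h g1 A - wt T A)%Z ->
    feasible (relabel (collapse (S :\: A) q) h) (collapse (S :\: A) q @: S)
      (push (collapse (S :\: A) q) S T) q g1) ->
  feasible h S T z g0.
Proof.
move=> wf AS rA qA zA [g1 [sg1 gT1 gz1]] H2.
have rS : r \in collapse A r @: S by rewrite imset_collapse // setU11.
have := gT1 r rS; rewrite (net_relabel _ _ _ wf) push1 pre_collapse // => gA.
have [g2 [sg2 gT2 gz2]] := H2 g1 sg1 gA.
pose bth e := ((h e).1 \in A) && ((h e).2 \in A).
exists (fun e => if bth e then g2 e else g1 e); split.
- by move=> e; case: ifP.
- move=> v vS; case: (boolP (v \in A)) => vA.
    have vD : v \in S :\: (S :\: A) by rewrite !inE vS vA.
    have vI : v \in collapse (S :\: A) q @: S.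
      by rewrite imset_collapse ?subsetDl // !inE vS vA orbT.
    have := gT2 v vI; rewrite (net_relabel _ _ _ wf) push1 pre_collapse1 // wt1.
    congr (is_true (_ %| _ - _)%Z); apply: eq_bigr => e _.
    case: ifP => // be; have [s1 s2] := wf e.
    case: (boolP (crossing A (h e))) => ce.
      rewrite gz2 // (crossing_relabel _ _ _ wf) pre_collapse ?subsetDl //.
      by rewrite (crossingD _ wf).
    move: be ce; rewrite /bth /crossing /incid !inE.
    case: (boolP ((h e).1 \in A)) => h1; case: (boolP ((h e).2 \in A)) => h2 //= _ _.
    case: eqP => [h1v|_]; first by rewrite h1v vA in h1.
    case: eqP => [h2v|_]; first by rewrite h2v vA in h2.
    by rewrite !mulr0.
  have vD : v \in S :\: A by rewrite !inE vS vA.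
  have vI : v \in collapse A r @: S by rewrite imset_collapse // !inE vS vA orbT.
  have := gT1 v vI; rewrite (net_relabel _ _ _ wf) push1 pre_collapse1 // wt1.
  congr (is_true (_ %| _ - _)%Z); apply: eq_bigr => e _.
  case: ifP => // /andP[h1 h2]; rewrite /incid !inE.
  case: eqP => [h1v|_]; first by rewrite h1v (negPf vA) in h1.
  case: eqP => [h2v|_]; first by rewrite h2v (negPf vA) in h2.
  by rewrite !mulr0.
- have nz u : u \in A -> (u == z) = false.
    by move=> uA; apply/negP => /eqP uz; rewrite -uz uA in zA.
  move=> e ez; case: ifP => [/andP[h1 h2]|_].
    by move: ez; rewrite /crossing !inE !nz.
  apply: gz1; move: ez; rewrite /crossing !inE /= /collapse.
  case: ifP => h1; case: ifP => h2 //.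
  - by rewrite !nz.
  - by rewrite (nz _ h1) (nz _ rA).
  - by rewrite (nz _ h2) (nz _ rA).
Qed.

(** The hypotheses of the theorem of Lovasz, Thomassen, Wu and Zhang; [v0] is the
    only vertex allowed to have a small degree, provided that its weight is 0. *)
Record admissible h S T z g0 v0 : Prop := Admissible {
  adm_within : within h S;
  adm_root : z \in S;
  adm_sign : sign g0;
  adm_parity : forall A, A \subset S -> (2 %| wt T A - (deg h A)%:Z)%Z;
  adm_total : (6 %| wt T S)%Z;
  adm_preflow : (3 %| net h g0 [set z] - T z)%Z;
  adm_root_deg : (deg h [set z] <= 4 + dist6 (T z))%N;
  adm_cut : forall A, A \subset S :\ z -> A != set0 -> A != S :\ z ->
    (A = [set v0] /\ dist6 (T v0) = 0%N) \/ (4 + dist6 (wt T A) <= deg h A)%N }.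

(** Cuts of a contraction are cuts of the graph, so only the conditions at the
    root have to be checked again. *)
Lemma admissible_relabel phi h S T z g0 v0 g1 : admissible h S T z g0 v0 -> sign g1 ->
  (3 %| net h g1 (pre phi S [set phi z]) - wt T (pre phi S [set phi z]))%Z ->
  (deg h (pre phi S [set phi z]) <= 4 + dist6 (wt T (pre phi S [set phi z])))%N ->
  admissible (relabel phi h) (phi @: S) (push phi S T) (phi z) g1 (phi v0).
Proof.
move=> [wf zS sg par tot z3 zd cut] sg1 n1 d1; split => //.
- exact: within_relabel.
- exact: imset_f.
- move=> A sA; rewrite wt_push (deg_relabel _ _ wf); apply: par; exact: pre_sub.
- by rewrite wt_push pre_imset.
- by rewrite (net_relabel _ _ _ wf) push1.
- by rewrite (deg_relabel _ _ wf) push1.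
move=> A sA An0 AnS; rewrite wt_push (deg_relabel _ _ wf).
have sAS : A \subset phi @: S by apply: subset_trans sA (subsetDl _ _).
have imA := image_pre sAS.
have := cut (pre phi S A); case.
- apply/subsetP=> u; rewrite !inE => /andP[uS uA]; rewrite uS andbT.
  by apply: contraTneq uA => ->; apply/negP => /(subsetP sA); rewrite !inE eqxx.
- by apply: contra_neq An0 => A0; rewrite -imA A0 imset0.
- apply: contra_neq AnS => pA; apply/eqP; rewrite eqEsubset sA; apply/subsetP=> w.
  rewrite !inE => /andP[wz /imsetP[u uS wu]]; rewrite -imA pA wu; apply: imset_f.
  by rewrite !inE uS andbT; apply: contraNneq wz => uz; rewrite wu uz.
- move=> [pA m0]; left; rewrite -imA pA imset_set1; split=> //.
  by rewrite push1 -imset_set1 -pA imA pA wt1.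
- by right.
Qed.

End Contraction.

(** * Spare boundary edges *)

Section SignedSums.

Variables (E : finType).

(** Used to direct an even number of parallel edges half one way, half the other. *)
Lemma balanced_signs (F : {set E}) : ~~ odd #|F| ->
  exists2 s : E -> int, sign s & \sum_(e in F) s e = 0.
Proof.
suff: forall n, #|F| = n -> exists2 s : E -> int, sign s & \sum_(e in F) s e = (odd #|F|)%:Z.
  by move=> /(_ _ erefl) [s ss sF] /negPf oF; exists s; rewrite // sF oF.
move=> n; elim: n F => [|n IH] F cF.
  exists (fun=> 1); first by left.
  by move/eqP: cF; rewrite cards_eq0 => /eqP ->; rewrite big_set0 cards0.
have /card_gt0P [e eF] : (0 < #|F|)%N by rewrite cF.
have cF' : #|F :\ e| = n by have := cardsD1 e F; rewrite eF; lia.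
have [s ss sF] := IH _ cF'; exists (upd s e (if odd n then -1 else 1)).
  by move=> f; rewrite /upd; case: eqP => // _; case: (odd n); [right | left].
rewrite (big_setD1 e) //= upd_eq (eq_bigr s) => [|f]; last first.
  by rewrite !inE => /andP[fe _]; rewrite upd_neq.
by rewrite sF cF' cF /=; case: (odd n).
Qed.

End SignedSums.

Lemma dist6_le3 t : (dist6 t <= 3)%N.
Proof. by rewrite /dist6; lia. Qed.

Section Flow.

Variables E V : finType.
Implicit Types (h : E -> V * V) (A B S : {set V}) (p : V * V).
Implicit Types (g : E -> int) (T : V -> int).

Lemma set1_or_large A : A != set0 -> (exists w, A = [set w]) \/ (1 < #|A|)%N.
Proof.
rewrite -card_gt0 => A0; case: (ltnP 1 #|A|) => [|A1]; first by right.
by left; apply/cards1P; lia.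
Qed.

(** The root has degree at most 7, so one vertex or one edge off the root
    outweighs any change at the root. *)
Definition measure h S z := (8 * (#|S| + edges_off_root h z) + deg h [set z])%N.

Definition solved_below n := forall h S T z g0 v0,
  admissible h S T z g0 v0 -> (measure h S z < n)%N -> feasible h S T z g0.

(** By parity a set [A] without slack has exactly 4 + |T(A)| boundary edges.  This
    is the bound on the degree of a root, so [A] can be contracted first and its
    complement taken as a new root afterwards. *)
Lemma flow_slack h S T z g0 v0 A : admissible h S T z g0 v0 -> solved_below (measure h S z) ->
  A \subset S :\ z -> (1 < #|A|)%N -> A != S :\ z ->
  feasible h S T z g0 \/ (6 + dist6 (wt T A) <= deg h A)%N.
Proof.
move=> R IH sA A1 AnS; have [wf zS sg par tot z3 zd cut] := R.
case: (leqP (6 + dist6 (wt T A)) (deg h A)) => [|dA]; [by right|left].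
have AS : A \subset S by apply: subset_trans sA (subsetDl _ _).
have zA : z \notin A by apply/negP => /(subsetP sA); rewrite !inE eqxx.
(* By parity the boundary has exactly the size allowed for a root. *)
have {}dA : deg h A = (4 + dist6 (wt T A))%N.
  have := par A AS; case: (cut A sA _ AnS); first by rewrite -card_gt0; lia.
    by move=> [A1' _]; rewrite A1' cards1 in A1.
  by rewrite /dist6 in dA *; lia.
have [r rA] : exists r, r \in A by apply/card_gt0P; lia.
have zD : z \in S :\: A by rewrite inE zA zS.
apply: (@feasible_glue _ _ h S T A r z z g0) => //.
  have cz : collapse A r z = z by rewrite /collapse (negPf zA).
  have := @admissible_relabel _ _ (collapse A r) _ _ _ _ _ _ g0 R.
  rewrite cz pre_collapse1 // wt1 => /(_ sg z3 zd) R'.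
  apply: IH R' _; rewrite /measure (deg_relabel _ _ wf) pre_collapse1 //.
  have := edges_off_root_relabel (collapse A r) h z; rewrite cz.
  by have := card_collapse AS rA A1; clear; lia.
move=> g1 sg1 n1; have sD : S :\: A \subset S := subsetDl _ _.
have cz : collapse (S :\: A) z z = z by rewrite /collapse zD.
have := @admissible_relabel _ _ (collapse (S :\: A) z) _ _ _ _ _ _ g1 R.
rewrite cz pre_collapse // netD // degD // wtD // => R'.
apply: (IH _ _ _ _ _ (collapse (S :\: A) z v0)).
  apply: R' => //; first by move: tot n1; clear; lia.
  by rewrite dA; move: tot; clear; rewrite /dist6; lia.
rewrite /measure (deg_relabel _ _ wf) pre_collapse // degD // dA.
have := edges_off_root_relabel (collapse (S :\: A) z) h z; rewrite cz.
have D1 : (1 < #|S :\: A|)%N.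
  rewrite (cardsD1 z) zD ltnS card_gt0; apply: contra_neq AnS => S0.
  apply/eqP; rewrite eqEsubset sA -setD_eq0 -S0; apply/eqP/setP=> u; rewrite !inE.
  by rewrite andbCA.
have := card_collapse sD zD D1; have := dist6_le3 (wt T A); clear; lia.
Qed.

End Flow.

(** * Lifting a pair of edges *)

Section Split.

Variables E V : finType.
Implicit Types (h : E -> V * V) (A B S : {set V}) (p : V * V).
Implicit Types (g : E -> int) (T : V -> int).

Definition cut_slack h S T z := forall A, A \subset S :\ z -> (1 < #|A|)%N ->
  A != S :\ z -> (6 + dist6 (wt T A) <= deg h A)%N.

Lemma flow_slack_all h S T z g0 v0 : admissible h S T z g0 v0 -> solved_below E V (measure h S z) ->
  feasible h S T z g0 \/ cut_slack h S T z.
Proof.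
move=> R IH; case: (boolP [exists A : {set V}, [&& A \subset S :\ z, (1 < #|A|)%N,
    A != S :\ z & (deg h A < 6 + dist6 (wt T A))%N]]).
  case/existsP=> A /and4P[sA A1 AnS dA].
  by case: (flow_slack R IH sA A1 AnS) => [|dA']; [left | move: dA; rewrite ltnNge dA'].
rewrite negb_exists => /forallP H; right=> A sA A1 AnS.
by have := H A; rewrite sA A1 AnS /= -leqNgt.
Qed.

Lemma root_notin S z A : A \subset S :\ z -> (z \in A) = false.
Proof. by move=> sA; apply/negP=> /(subsetP sA); rewrite !inE eqxx. Qed.

Lemma joins_in h S e x y : within h S -> joins (h e) x y -> x \in S /\ y \in S.
Proof. by move=> /(_ e) [H H0] /orP[] /eqP he; rewrite he /= in H H0. Qed.

(** Lifting costs at most two boundary edges, and only to sets of at least two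
    vertices, since [x] and [y] are distinct; these have two to spare.  The vertex
    [v] itself becomes the exempt one. *)
Lemma flow_lift h S T z g0 v0 v e1 e2 x y :
  admissible h S T z g0 v0 -> solved_below E V (measure h S z) -> cut_slack h S T z ->
  dist6 (T v) = 0%N -> v \in S :\ z ->
  (forall A, A \subset S :\ z -> A != set0 -> A != S :\ z ->
    A = [set v] \/ (4 + dist6 (wt T A) <= deg h A)%N) ->
  joins (h e1) x v -> joins (h e2) y v -> x != v -> y != v -> x != y -> y != z ->
  feasible h S T z g0.
Proof.
move=> [wf zS sg par tot z3 zd _] IH SL mv; rewrite !inE => /andP[vz vS] cut j1 j2 xv yv xy yz.
have [xS _] := joins_in wf j1; have [yS _] := joins_in wf j2.
have e12 : e1 != e2.
  apply: contraNneq xy => e12; rewrite -e12 in j2; have := joins_crossing [set x] j1.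
  by rewrite (joins_crossing _ j2) !inE eqxx [v == x]eq_sym (negPf xv) [x == y]eq_sym; case: (y == x).
have e21 : e2 != e1 by rewrite eq_sym.
pose h' := upd (upd h e1 (x, y)) e2 (y, y).
pose g' := upd g0 e1 (leaving (h e1) x * g0 e1).
have deg' A : (deg h' A + ((x \in A) != (v \in A)) + ((y \in A) != (v \in A)) =
               deg h A + ((x \in A) != (y \in A)))%N.
  have := deg_upd (upd h e1 (x, y)) e2 (y, y) A; have := deg_upd h e1 (x, y) A.
  rewrite -/h' (upd_neq _ _ e21) (joins_crossing _ j1) (joins_crossing _ j2) /crossing /= eqxx.
  by clear; lia.
have in' : (edges_off_root h' z).+1 = edges_off_root h z.
  have := edges_off_root_upd (upd h e1 (x, y)) e2 (y, y) z; have := edges_off_root_upd h e1 (x, y) z.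
  rewrite -/h' (upd_neq _ _ e21) (joins_off_root _ j1) (joins_off_root _ j2) /off_root /= eqxx.
  by rewrite xv yv vz yz xy /=; clear; lia.
have degz : deg h' [set z] = deg h [set z].
  by have := deg' [set z]; rewrite !inE (negPf vz) (negPf yz); clear; lia.
apply: (@feasible_lift _ _ h S T z g0 e1 e2 v x y) => //.
apply: (IH _ _ _ _ _ v); last by rewrite -/h' /measure degz -in'; clear; lia.
split => //.
- by do 2![apply: within_upd => //=].
- move=> e; rewrite /upd; case: eqP => // _.
  by case: (leaving_sign (h e1) x) => ->; case: (sg e1) => ->; [left|right|right|left].
- move=> A AS; have := par A AS; have := deg' A; rewrite -/h'; clear.
  by do 3!case: (_ \in A) => /=; lia.
- have -> // : net (upd (upd h e1 (x, y)) e2 (y, y)) g' [set z] = net h g0 [set z].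
  rewrite !net_upd net_updg /g' upd_eq (upd_neq _ _ e21) (upd_neq _ _ e21).
  rewrite (joins_incid _ xv j1) (joins_incid _ yv j2) /incid /= !inE (negPf vz) (negPf yz).
  by case: (leaving_sign (h e1) x) => ->; ring.
- by rewrite -/h' degz.
move=> A sA A0 AnS; have D := deg' A; rewrite -/h'.
case: (set1_or_large A0) => [[w Aw]|A1].
  case: (cut A sA A0 AnS) => [->|d4]; first by left.
  case: (v =P w) => [vw|vw]; [by left; rewrite Aw -vw | right; move: d4 D; rewrite {}Aw !inE].
  case: (x =P w) => [wx|_]; case: (y =P w) => [wy|_]; case: (v =P w) => [//|_] /=; try (clear; lia).
  by move: xy; rewrite wx wy eqxx.
right; have := SL A sA A1 AnS; move: D; clear.
by do 3!case: (_ \in A) => /=; lia.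
Qed.

End Split.

(** * Vertices of weight zero *)

Section Balanced.

Variables E V : finType.
Implicit Types (h : E -> V * V) (A B S : {set V}) (p : V * V).
Implicit Types (g : E -> int) (T : V -> int).

Lemma degE h A : deg h A = #|[set e | crossing A (h e)]|.
Proof.
rewrite /deg -sum1dep_card [RHS]big_mkcond; apply: eq_bigr => e _.
by case: (crossing A (h e)).
Qed.

Lemma crossing_end v p : crossing [set v] p -> exists2 w, w != v & joins p w v.
Proof.
case: p => a b; rewrite /crossing /joins /= !inE.
case: (a =P v) => [->|/eqP av]; case: (b =P v) => [->|/eqP bv] //= _.
  by exists b; rewrite // eqxx orbT.
by exists a; rewrite // eqxx.
Qed.

Lemma net_pair h g u v : u != v -> net h g [set u; v] = net h g [set u] + net h g [set v].
Proof. by move=> uv; rewrite net_sum big_setU1 ?inE //= big_set1. Qed.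

(** If [v] has no neighbour but [x], contract [vx]; the edges between them are
    even in number and are directed so as to cancel at [v]. *)
Lemma flow_absorb h S T z g0 v0 v x :
  admissible h S T z g0 v0 -> solved_below E V (measure h S z) -> dist6 (T v) = 0%N ->
  v \in S :\ z -> x \in S :\ z -> x != v ->
  (forall e w, w != v -> joins (h e) w v -> w = x) ->
  feasible h S T z g0.
Proof.
move=> R IH mv; have [wf zS sg par tot z3 zd cut] := R.
rewrite !inE => /andP[vz vS] /andP[xz xS] xv only.
have vx : v != x by rewrite eq_sym.
pose A := [set v; x].
have AS : A \subset S by apply/subsetP=> u; rewrite !inE => /orP[] /eqP ->.
have xA : x \in A by rewrite !inE eqxx orbT.
have zA : z \notin A by rewrite !inE eq_sym (negPf vz) eq_sym (negPf xz).
have A1 : (1 < #|A|)%N by rewrite cards2 eq_sym xv.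
have zD : z \in S :\: A by rewrite inE zA zS.
have cz : collapse A x z = z by rewrite /collapse (negPf zA).
have := @admissible_relabel _ _ (collapse A x) _ _ _ _ _ _ g0 R.
rewrite cz pre_collapse1 // wt1 => /(_ sg z3 zd) R'.
have [|g1 [sg1 gT1 gz1]] := IH _ _ _ _ _ _ R'.
  rewrite /measure (deg_relabel _ _ wf) pre_collapse1 //.
  have := edges_off_root_relabel (collapse A x) h z; rewrite cz.
  by have := card_collapse AS xA A1; clear; lia.
have xI : x \in collapse A x @: S by rewrite imset_collapse // setU11.
have netA : (3 %| net h g1 A - wt T A)%Z.
  by have := gT1 x xI; rewrite (net_relabel _ _ _ wf) push1 pre_collapse.
pose F := [set e | crossing [set v] (h e)].
have FP e : crossing [set v] (h e) -> joins (h e) x v.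
  by move=> /crossing_end [w wv j]; rewrite -(only e w wv j).
have oF : ~~ odd #|F|.
  have := par [set v]; rewrite sub1set vS wt1 => /(_ isT).
  rewrite degE -/F.
  by move: mv; clear; rewrite /dist6; lia.
have [s ss sF] := balanced_signs oF.
pose g e := if e \in F then s e * leaving (h e) v else g1 e.
have netw B : (v \in B) = (x \in B) -> net h g B = net h g1 B.
  move=> vB; apply: eq_bigr => e _; rewrite /g; case: ifP => //.
  rewrite inE => /FP j; rewrite (joins_incid _ xv j) vB.
  by rewrite subrr !mulr0.
have netv : net h g [set v] = 0.
  rewrite -[RHS]sF [RHS]big_mkcond; apply: eq_bigr => e _; rewrite /g inE.
  case: ifP => [ce|]; last first.
    by rewrite /crossing /incid => /negbFE/eqP ->; rewrite subrr mulr0.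
  have := FP e ce; rewrite joinsC => j; rewrite (joins_incid _ vx j).
  rewrite !inE eqxx (negPf xv).
  by case: (leaving_sign (h e) v) => ->; clear; lia.
exists g; split.
- move=> e; rewrite /g; case: ifP => _ //.
  by case: (ss e) => ->; case: (leaving_sign (h e) v) => ->; [left|right|right|left].
- have v3 : (3 %| T v)%Z by move: mv; clear; rewrite /dist6; lia.
  move=> w wS; case: (w =P v) => [->|/eqP wv]; first by rewrite netv; move: v3; clear; lia.
  case: (w =P x) => [->|/eqP wx].
    have := netw A; rewrite !inE !eqxx orbT => /(_ erefl).
    rewrite (net_pair _ _ vx) netv add0r => ->.
    move: netA v3; rewrite [A]setUC wtU ?wt1; last by rewrite disjoints1 !inE.
    by clear; lia.
  rewrite netw; last by rewrite !inE eq_sym (negPf wv) eq_sym (negPf wx).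
  have wD : w \in S :\: A by rewrite !inE (negPf wv) (negPf wx).
  have wI : w \in collapse A x @: S.
    by rewrite imset_collapse // inE wD orbT.
  have := gT1 w wI; rewrite (net_relabel _ _ _ wf) push1 pre_collapse1 //.
  by rewrite wt1.
- move=> e ez; have eF : e \notin F.
    rewrite inE; apply: contraL ez => /FP j.
    by rewrite (joins_crossing _ j) !inE (negPf xz) (negPf vz).
  rewrite /g (negPf eF) gz1 // (crossing_relabel _ _ _ wf) pre_collapse1 //.
Qed.

(** If all edges at [v] go to the root, the remaining vertices have fewer boundary
    edges than the root, against the cut condition; in all other cases [v] can be
    lifted or absorbed. *)
Lemma flow_zero h S T z g0 v0 v :
  admissible h S T z g0 v0 -> solved_below E V (measure h S z) -> cut_slack h S T z -> (2 < #|S|)%N ->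
  v \in S :\ z -> dist6 (T v) = 0%N -> feasible h S T z g0.
Proof.
move=> R IH SL S3 vS mv; have [wf zS sg par tot z3 zd cut] := R.
(* If the exempt vertex has weight 0, it must be the one that is lifted off;
   otherwise there is none, and any vertex of weight 0 may be exempted. *)
wlog cutv : v vS mv / (forall A, A \subset S :\ z -> A != set0 -> A != S :\ z ->
    A = [set v] \/ (4 + dist6 (wt T A) <= deg h A)%N).
  move=> W; case: (boolP (v0 \in S :\ z)) => v0S.
    case: (dist6 (T v0) =P 0%N) => mv0.
      by apply: (W v0) => // A sA A0 AnS; case: (cut A sA A0 AnS) => [[->]|]; [left|right].
    by apply: (W v) => // A sA A0 AnS; case: (cut A sA A0 AnS) => [[_ /mv0]|] //; right.
  apply: (W v) => // A sA A0 AnS; case: (cut A sA A0 AnS) => [[AE _]|]; last by right.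
  by move: sA; rewrite AE sub1set (negPf v0S).
have := vS; rewrite !inE => /andP[vz vSS].
case: (boolP [exists e1, exists e2, exists x, exists y,
   [&& joins (h e1) x v, joins (h e2) y v, x != v, y != v & x != y]]).
  case/existsP=> e1 /existsP[e2 /existsP[x /existsP[y /and5P[j1 j2 xv yv xy]]]].
  case: (y =P z) => [yz|/eqP yz]; last exact: (flow_lift R IH SL mv vS cutv j1 j2).
  by apply: (flow_lift R IH SL mv vS cutv j2 j1) => //; [rewrite eq_sym | rewrite -yz].
move=> H; have only e1 e2 x y : joins (h e1) x v -> joins (h e2) y v -> x != v -> y != v -> x = y.
  move=> j1 j2 xv yv; apply/eqP; apply: contraNT H => xy.
  apply/existsP; exists e1; apply/existsP; exists e2; apply/existsP; exists x.
  by apply/existsP; exists y; rewrite j1 j2 xv yv xy.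
case: (boolP [exists e, crossing [set v] (h e)]) => [/existsP[e /crossing_end[x xv j]]|NE].
  case: (x =P z) => [xz|/eqP xz]; last first.
    have [xS _] := joins_in wf j.
    apply: (flow_absorb R IH mv vS (x := x)); rewrite ?inE ?xz // => e' w wv j'.
    exact: only j' j wv xv.
  exfalso; pose A := S :\ z :\ v; have sA : A \subset S :\ z := subsetDl _ _.
  have dA : (deg h A + deg h [set v] = deg h [set z])%N.
    rewrite /deg -big_split /=; apply: eq_bigr => f _; have [s1 s2] := wf f.
    case: (boolP (crossing [set v] (h f))) => [/crossing_end[w wv jw]|nv].
      have wz : w = z by rewrite -xz; exact: only jw j wv xv.
      rewrite !(joins_crossing _ jw) wz (root_notin sA) [v \in A]inE !inE !eqxx.
      by rewrite (negPf vz).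
    move: nv; rewrite /crossing !inE s1 s2 !andbT negbK => /eqP vv.
    case: ((h f).1 =P v) vv => [-> /esym/eqP ->|_ /esym/negbT]; first by rewrite !eqxx.
    by move=> /negPf -> /=; do 2!case: (_ == z).
  have d1 : (0 < deg h [set v])%N.
    rewrite /deg (bigD1 e) //= (joins_crossing _ j) !inE eqxx.
    by rewrite (negPf xv).
  have cA : #|A| = (#|S| - 2)%N.
    have := cardsD1 z S; have := cardsD1 v (S :\ z); rewrite vS zS -/A.
    by clear; lia.
  case: (cutv A sA).
  - by rewrite -card_gt0 cA; move: S3; clear; lia.
  - by apply: contraTneq vS => <-; rewrite !inE eqxx.
  - by move/setP/(_ v); rewrite !inE !eqxx.
  have -> : wt T A = wt T S - T z - T v.
    rewrite /A !wtD ?wt1 ?sub1set //.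
  by move: zd tot mv dA d1; rewrite /dist6; clear; lia.
have [x xA] : exists x, x \in S :\ z :\ v.
  apply/card_gt0P; have := cardsD1 z S; have := cardsD1 v (S :\ z).
  by rewrite vS zS; move: S3; clear; lia.
move: (xA); rewrite 2!inE => /andP[xv xS].
apply: (flow_absorb R IH mv vS xS xv) => e w wv j; case/existsP: NE; exists e.
by rewrite (joins_crossing _ j) !inE eqxx (negPf wv).
Qed.

End Balanced.

(** * Extending the directions at a root *)

Section Main.

Variables E V : finType.
Implicit Types (h : E -> V * V) (A B S P : {set V}) (p : V * V).
Implicit Types (g : E -> int) (T : V -> int).

(** The weights that are 1, 2 or 3 modulo 6: sending one unit out of such a vertex
    brings its weight closer to a multiple of 6. *)
Definition positive6 (t : int) : bool := (dist6 (t - 1) < dist6 t)%N.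

Definition cut_bound h S T z := forall A, A \subset S :\ z -> A != set0 ->
  A != S :\ z -> (4 + dist6 (wt T A) <= deg h A)%N.

(** If [P] and its complement [N] off the root are not joined, then the root has
    degree d(P) + d(N), at least 8 + |T(P)| + |T(N)|, which exceeds 4 + |T z|. *)
Lemma exit_edge h S T z g0 v0 P : admissible h S T z g0 v0 -> cut_bound h S T z ->
  P \subset S :\ z -> P != set0 -> P != S :\ z ->
  exists e x y, [/\ x \in P, y \in S :\ z, y \notin P & joins (h e) x y].
Proof.
move=> [wf zS sg par tot z3 zd _] cut sP P0 PS.
case: (boolP [exists e, exists x, exists y,
    [&& x \in P, y \in S :\ z, y \notin P & joins (h e) x y]]).
  by case/existsP=> e /existsP[x /existsP[y /and4P[]]]; exists e, x, y.
move=> H; exfalso; have no e x y : x \in P -> y \in S :\ z -> y \notin P -> ~~ joins (h e) x y.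
  move=> xP yS yP; apply: contra H => j; apply/existsP; exists e; apply/existsP; exists x.
  by apply/existsP; exists y; rewrite xP yS yP j.
pose N := (S :\ z) :\: P; have sN : N \subset S :\ z := subsetDl _ _.
have dz : (deg h P + deg h N = deg h [set z])%N.
  rewrite /deg -big_split /=; apply: eq_bigr => e _; have [s1 s2] := wf e.
  have n1 : [&& (h e).1 \in P, (h e).2 \in S :\ z & (h e).2 \notin P] = false.
    apply/negP=> /and3P[a b c]; have := no e _ _ a b c.
    by rewrite /joins -surjective_pairing eqxx.
  have n2 : [&& (h e).2 \in P, (h e).1 \in S :\ z & (h e).1 \notin P] = false.
    apply/negP=> /and3P[a b c]; have := no e _ _ a b c.
    by rewrite /joins -surjective_pairing eqxx orbT.
  have Pz u : (u \in P) && (u == z) = false.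
    by apply/negP=> /andP[/(subsetP sP)]; rewrite !inE => /andP[/negPf ->].
  move: n1 n2 (Pz (h e).1) (Pz (h e).2); rewrite /crossing !inE s1 s2 !andbT; clear.
  by case: (_.1 \in P); case: (_.2 \in P); case: (_.1 == z); case: (_.2 == z).
have N0 : N != set0.
  apply: contra_neq PS => N0; apply/eqP; rewrite eqEsubset sP /=.
  by have := setD_eq0 (S :\ z) P; rewrite -/N N0 eqxx => <-.
have NS : N != S :\ z.
  apply: contra_neq P0 => NS; apply/setP=> u; rewrite inE; apply/negP=> uP.
  by have := subsetP sP u uP; rewrite -NS !inE uP.
have := cut P sP P0 PS; have := cut N sN N0 NS.
rewrite {1}/N !wtD // ?sub1set // wt1.
by move: dz zd tot; rewrite /dist6; clear; lia.
Qed.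

(** At an end of suitable sign (or at the root) the loss of one boundary edge is
    compensated by the weight; larger sets use their slack. *)
Lemma flow_delete h S T z g0 v0 e x y :
  admissible h S T z g0 v0 -> solved_below E V (measure h S z) -> cut_slack h S T z -> cut_bound h S T z ->
  x != y -> joins (h e) x y -> x = z \/ positive6 (T x) -> y = z \/ positive6 (- T y) ->
  (crossing [set z] (h e) -> g0 e = leaving (h e) x) ->
  feasible h S T z g0.
Proof.
move=> [wf zS sg par tot z3 zd _] IH SL cut xy j px py ge.
have [xS yS] := joins_in wf j.
apply: (feasible_del xy j ge).
have deg' A : (deg (upd h e (x, x)) A + ((x \in A) != (y \in A)) = deg h A)%N.
  by have := deg_upd h e (x, x) A; rewrite (joins_crossing _ j) /crossing eqxx; clear; lia.
have wt' A : wt (bump (bump T x (-1)) y 1) A = wt T A - (x \in A)%:Z + (y \in A)%:Z.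
  by rewrite !wt_bump; clear; lia.
apply: (IH _ _ _ _ _ v0); last first.
  have := deg' [set z]; have := edges_off_root_upd h e (x, x) z.
  rewrite (joins_off_root _ j) /off_root !inE eqxx xy /= /measure.
  case: (x =P z) => [xz|_]; case: (y =P z) => [yz|_] /=; try (clear; lia).
  by move: xy; rewrite xz yz eqxx.
split => //.
- exact: within_upd.
- move=> A AS; have := par A AS; have := deg' A; rewrite wt'; clear.
  by do 2!case: (_ \in A) => /=; lia.
- by rewrite wt' xS yS; move: tot; clear; lia.
- have -> : net (upd h e (x, x)) g0 [set z] - (bump (bump T x (-1)) y 1) z =
            net h g0 [set z] - T z; last by [].
  rewrite net_upd /bump; have := ge; rewrite (joins_crossing _ j) (joins_incid _ xy j).
  rewrite /incid /= !inE ![_ == z]eq_sym.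
  case: (z =P x) => [zx|_]; case: (z =P y) => [zy|_] /=; rewrite ?eqxx; try (clear; lia).
    by move=> /(_ isT) ->; case: (leaving_sign (h e) x) => ->; clear; lia.
  by move=> /(_ isT) ->; case: (leaving_sign (h e) x) => ->; clear; lia.
- have := deg' [set z]; have := wt' [set z]; rewrite !wt1 => ->.
  move: zd; rewrite !inE; clear.
  by do 2!case: (_ == z) => /=; rewrite /dist6; lia.
move=> A sA A0 AnS; right; rewrite wt'; have := deg' A.
case: (set1_or_large A0) => [[w Aw]|A1].
  have := cut A sA A0 AnS; rewrite Aw wt1 !inE.
  have wz : w != z by have := subsetP sA w; rewrite Aw !inE eqxx => /(_ isT) /andP[].
  case: (x =P w) => [xw|_]; case: (y =P w) => [yw|_] /=.
  - by move: xy; rewrite xw yw eqxx.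
  - case: px => [xz|]; first by rewrite -xw xz eqxx in wz.
    by rewrite xw /positive6 /dist6; clear; lia.
  - case: py => [yz|]; first by rewrite -yw yz eqxx in wz.
    by rewrite yw /positive6 /dist6; clear; lia.
  - by rewrite subr0 addr0; clear; lia.
have := SL A sA A1 AnS; clear.
by do 2!case: (_ \in A) => /=; rewrite /dist6; lia.
Qed.

(** All weights being positive, arcs into the root can be deleted.  Otherwise all
    edges leave the root, so T z is its degree modulo 6, which with the bound on
    the degree leaves at most 5. *)
Lemma flow_positive h S T z g0 v0 :
  admissible h S T z g0 v0 -> solved_below E V (measure h S z) -> cut_slack h S T z -> cut_bound h S T z ->
  (2 < #|S|)%N -> {in S :\ z, forall v, positive6 (T v)} ->
  feasible h S T z g0.
Proof.
move=> R IH SL cut S3 allpos; have [wf zS sg par tot z3 zd _] := R.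
have cS := cardsD1 z S; rewrite zS in cS.
case: (boolP [exists e, crossing [set z] (h e) && (g0 e != leaving (h e) z)]).
  case/existsP=> e /andP[/crossing_end[x xz j] gz]; have [xS _] := joins_in wf j.
  apply: (flow_delete R IH SL cut xz j); [by right; apply: allpos; rewrite !inE xz | by left |].
  move=> _; move: gz; rewrite (leavingC xz j).
  by case: (sg e) => ->; case: (leaving_sign (h e) x) => ->.
rewrite negb_exists => /forallP out.
have {}out e : crossing [set z] (h e) -> g0 e = leaving (h e) z.
  by move=> ce; have := out e; rewrite ce /= negbK => /eqP.
have netz : net h g0 [set z] = (deg h [set z])%:Z.
  rewrite /net /deg (big_morph Posz PoszD (erefl _)); apply: eq_bigr => e _.
  case: (boolP (crossing [set z] (h e))) => ce; last first.
    by move: ce; rewrite /crossing /incid => /negPn/eqP ->; rewrite subrr mulr0.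
  rewrite out //; have [x xz] := crossing_end ce; rewrite joinsC => j.
  rewrite (joins_incid _ _ j); last by rewrite eq_sym.
  by rewrite !inE eqxx (negPf xz); case: (leaving_sign (h e) z) => ->.
have tz : (6 %| T z - (deg h [set z])%:Z)%Z.
  have := par [set z]; rewrite sub1set zS wt1 => /(_ isT).
  by move: z3; rewrite netz; clear; lia.
have dz : (deg h [set z] <= 5)%N by move: zd tz; rewrite /dist6; clear; lia.
have pick x : x \in S :\ z -> exists e y, [/\ y \in S :\ z, y != x & joins (h e) y x].
  move=> xS; case: (@exit_edge h S T z g0 v0 [set x] R cut).
  - by rewrite sub1set.
  - by apply/set0Pn; exists x; rewrite inE.
  - by apply: contraTneq S3 => xSE; rewrite cS -xSE cards1.
  move=> e [x' [y []]]; rewrite !inE => /eqP -> yS yx j.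
  by exists e, y; split; rewrite ?inE // joinsC.
have deg' e x y A : joins (h e) y x -> A \subset S :\ z ->
    (deg (upd h e (z, x)) A + ((x \in A) != (y \in A)) = deg h A + (x \in A))%N.
  move=> j sA; have := deg_upd h e (z, x) A.
  rewrite (joins_crossing _ j) /crossing /= (root_notin sA).
  by clear; do 2!case: (_ \in A) => /=; lia.
have degz e x y : joins (h e) y x -> x != z -> y != z ->
    deg (upd h e (z, x)) [set z] = (deg h [set z]).+1.
  move=> j xz yz; have := deg_upd h e (z, x) [set z].
  by rewrite (joins_crossing _ j) /crossing /= !inE eqxx (negPf xz) (negPf yz) /=; clear; lia.
have ins e x y : joins (h e) y x -> x != z -> y != z -> y != x ->
    (edges_off_root (upd h e (z, x)) z).+1 = edges_off_root h z.
  move=> j xz yz yx; have := edges_off_root_upd h e (z, x) z.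
  by rewrite (joins_off_root _ j) /off_root /= eqxx yx xz yz andbF /=; clear; lia.
have netz' e x y g : joins (h e) y x -> x != z -> y != z ->
    net (upd h e (z, x)) g [set z] = net h g [set z] + g e.
  move=> j xz yz; rewrite net_upd; have := joins_crossing [set z] j.
  rewrite /incid /crossing /= !inE eqxx (negPf xz) (negPf yz) /= => /negbFE/eqP ->.
  by clear; lia.
have par' e x y A : joins (h e) y x -> A \subset S -> (2 %| wt T A - (y \in A)%:Z +
    (z \in A)%:Z - (deg (upd h e (z, x)) A)%:Z)%Z.
  move=> j AS; have := par A AS; have := deg_upd h e (z, x) A.
  rewrite (joins_crossing _ j) /crossing /=; clear.
  by do 3!case: (_ \in A) => /=; lia.
(* At a root of degree 5 one more leaving arc would give degree 6 and weight 6,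
   beyond the bound; the double exchange gives degree 6 and weight 2. *)
case: (ltnP 4 (deg h [set z])) => d5.
  have /existsP[f cf] : [exists f, crossing [set z] (h f)].
    apply: contraTT d5; rewrite negb_exists => /forallP nc.
    by rewrite /deg big1 // => f _; rewrite (negPf (nc f)).
  have [x xz jf] := crossing_end cf; have [xS _] := joins_in wf jf.
  have xSz : x \in S :\ z by rewrite !inE xz.
  have [e [y [ySz yx je]]] := pick x xSz.
  have := ySz; rewrite !inE => /andP[yz yS].
  have zx : z != x by rewrite eq_sym.
  have xy : x != y by rewrite eq_sym.
  rewrite joinsC in jf.
  apply: (feasible_double xy xz yz je jf (out f cf)).
  have wt' A : wt (bump (bump (bump T y (-1)) z (-3)) x 4) A =
      wt T A - (y \in A)%:Z - 3 * (z \in A)%:Z + 4 * (x \in A)%:Z.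
    by rewrite !wt_bump; clear; lia.
  apply: (IH _ _ _ _ _ v0); last first.
    by rewrite /measure (degz _ _ _ je) // -(ins _ _ _ je) //; move: (edges_off_root _ _) (deg _ _); clear; lia.
  split => //.
  - exact: within_upd.
  - by move=> d; rewrite /upd; case: eqP => _; [case: (sg f) => ->; [right|left] | case: eqP; [right|]].
  - move=> A AS; have := par' e x y A je AS; rewrite wt'; clear.
    by do 3!case: (_ \in A) => /=; lia.
  - by rewrite wt' xS yS zS; move: tot; clear; lia.
  - have fe : f != e.
      apply/eqP=> fe; move: cf; rewrite fe (joins_crossing _ je) !inE.
      by rewrite (negPf xz) (negPf yz).
    have := joins_crossing [set z] je; rewrite !inE (negPf xz) (negPf yz) /= => /negbFE/eqP ce.
    rewrite (netz' _ _ _ _ je) // upd_neq 1?eq_sym // upd_eq !net_updg.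
    rewrite upd_neq // (joins_incid _ zx jf) (out f cf) {1}/incid ce subrr mulr0.
    rewrite /bump !inE eqxx (negPf xz) (negPf zx) [z == y]eq_sym (negPf yz).
    by move: z3; case: (leaving_sign (h f) z) => ->; clear; lia.
  - rewrite (degz _ _ _ je) // /bump eqxx (negPf zx) [z == y]eq_sym (negPf yz).
    by move: dz d5 tz; rewrite /dist6; clear; lia.
  move=> A sA A0 AnS; right; rewrite wt' (root_notin sA); have := deg' e x y A je sA.
  case: (set1_or_large A0) => [[w Aw]|A1].
    have := cut A sA A0 AnS; rewrite Aw wt1 !inE.
    have wS : w \in S :\ z by apply: (subsetP sA); rewrite Aw inE.
    have := allpos w wS; rewrite /positive6 /dist6; move: (deg (upd _ _ _) _) => d'.
    by case: (x =P w) => _; case: (y =P w) => _ /=; clear; lia.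
  have := SL A sA A1 AnS; move: (deg (upd _ _ _) _) => d'; clear.
  by do 2!case: (_ \in A) => /=; rewrite /dist6; lia.
have [x xSz] : exists x, x \in S :\ z by apply/card_gt0P; move: cS S3; clear; lia.
have [e [y [ySz yx je]]] := pick x xSz.
have := ySz; rewrite !inE => /andP[yz yS].
have := xSz; rewrite !inE => /andP[xz xS].
have zx : z != x by rewrite eq_sym.
have xy : x != y by rewrite eq_sym.
apply: (feasible_move xy xz yz je).
have wt' A : wt (bump (bump T y (-1)) z 1) A = wt T A - (y \in A)%:Z + (z \in A)%:Z.
  by rewrite !wt_bump; clear; lia.
apply: (IH _ _ _ _ _ v0); last first.
  by rewrite /measure (degz _ _ _ je) // -(ins _ _ _ je) //; move: (edges_off_root _ _) (deg _ _); clear; lia.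
split => //.
- exact: within_upd.
- by move=> d; rewrite /upd; case: eqP => _; [left|].
- by move=> A AS; rewrite wt'; apply: par' je AS.
- by rewrite wt' yS zS; move: tot; clear; lia.
- have := joins_crossing [set z] je; rewrite !inE (negPf xz) (negPf yz) /= => /negbFE/eqP ce.
  rewrite (netz' _ _ _ _ je) // upd_eq net_updg {1}/incid ce subrr mulr0.
  rewrite /bump eqxx [z == y]eq_sym (negPf yz).
  by move: z3; clear; lia.
- rewrite (degz _ _ _ je) // /bump eqxx [z == y]eq_sym (negPf yz).
  by move: d5 tz; rewrite /dist6; clear; lia.
move=> A sA A0 AnS; right; rewrite wt' (root_notin sA); have := deg' e x y A je sA.
case: (set1_or_large A0) => [[w Aw]|A1].
  have := cut A sA A0 AnS; rewrite Aw wt1 !inE.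
  have wS : w \in S :\ z by apply: (subsetP sA); rewrite Aw inE.
  have := allpos w wS; rewrite /positive6 /dist6; move: (deg (upd _ _ _) _) => d'.
  by case: (x =P w) => _; case: (y =P w) => _ /=; clear; lia.
have := SL A sA A1 AnS; move: (deg (upd _ _ _) _) => d'; clear.
by do 2!case: (_ \in A) => /=; rewrite /dist6; lia.
Qed.

Lemma admissibleN h S T z g0 v0 : admissible h S T z g0 v0 ->
  admissible h S (fun v => - T v) z (fun e => - g0 e) v0.
Proof.
have dist6N t : dist6 (- t) = dist6 t by rewrite /dist6; clear; lia.
case=> [wf zS sg par tot z3 zd cut]; split => //.
- by move=> e; case: (sg e) => ->; [right|left].
- by move=> A AS; have := par A AS; rewrite wtN; clear; lia.
- by rewrite wtN; move: tot; clear; lia.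
- by rewrite netN; move: z3; clear; lia.
- by rewrite dist6N.
by move=> A sA A0 AS; rewrite wtN !dist6N; apply: cut.
Qed.

(** With at most one vertex off the root all edges are directed already, and the
    outflow of that vertex is forced. *)
Lemma small_flow h S T z g0 v0 : admissible h S T z g0 v0 -> (#|S| <= 2)%N ->
  feasible h S T z g0.
Proof.
move=> [wf zS sg par tot z3 zd cut] S2; exists g0; split=> // v vS.
case: (v =P z) => [-> //|/eqP vz].
have SE : S :\: [set z] = [set v].
  apply/esym/eqP; rewrite eqEcard sub1set !inE vz vS cards1 /=.
  by have := cardsD1 z S; rewrite zS; move: S2; clear; lia.
have := netD g0 wf (_ : [set z] \subset S); rewrite sub1set => /(_ zS).
rewrite SE => ->; have := wtD T (_ : [set z] \subset S); rewrite sub1set => /(_ zS).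
by rewrite SE !wt1 => ->; move: tot z3; clear; lia.
Qed.

(** A smallest counterexample has slack, no vertex of weight 0, and no edge joining
    vertices of opposite signs; reversing all directions makes the signs positive. *)
Theorem flow_of_admissible h S T z g0 v0 : admissible h S T z g0 v0 -> feasible h S T z g0.
Proof.
have [n] := ubnP (measure h S z); elim: n h S T z g0 v0 => // n IHn h S T z g0 v0 lt_n R.
have IH : solved_below E V (measure h S z).
  by move=> h' S' T' z' g' v' R' lt; apply: IHn R'; move: lt_n lt; clear; lia.
case: (leqP #|S| 2) => S3; first exact: small_flow R S3.
have [//|SL] := flow_slack_all R IH.
case: (boolP [exists v, (v \in S :\ z) && (dist6 (T v) == 0%N)]).
  by case/existsP=> v /andP[vS /eqP mv]; apply: (flow_zero R IH SL S3 vS mv).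
rewrite negb_exists => /forallP NZ.
have {}NZ v : v \in S :\ z -> dist6 (T v) <> 0%N.
  by move=> vS; have := NZ v; rewrite vS /= => /eqP.
have [wf zS sg par tot z3 zd cut] := R.
have st : cut_bound h S T z.
  move=> A sA A0 AS; case: (cut A sA A0 AS) => // [[AE m0]].
  by case: (NZ v0); rewrite // -sub1set -AE.
have dist6N t : dist6 (- t) = dist6 t by rewrite /dist6; clear; lia.
have negp v : v \in S :\ z -> ~~ positive6 (T v) -> positive6 (- T v).
  by move=> /NZ; rewrite /positive6 /dist6; clear; lia.
pose P := [set v in S :\ z | positive6 (T v)].
have sP : P \subset S :\ z by apply/subsetP=> u; rewrite inE => /andP[].
case: (P =P S :\ z) => [PS|/eqP PS].
  by apply: (flow_positive R IH SL st S3) => v; rewrite -PS inE => /andP[].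
case: (P =P set0) => [P0|/eqP P0].
  apply: feasibleN; apply: (flow_positive (admissibleN R) IH) => //.
  - by move=> A sA A1 AS; rewrite wtN dist6N; apply: SL.
  - by move=> A sA A0 AS; rewrite wtN dist6N; apply: st.
  move=> v vS; apply: negp => //; apply/negP=> pv.
  by have : v \in P; [rewrite inE vS | rewrite P0 inE].
have [e [x [y [xP yS yP j]]]] := exit_edge R st sP P0 PS.
have xy : x != y by apply: contraNneq yP => <-.
move: (xP); rewrite inE => /andP[xS px].
have py : positive6 (- T y) by apply: negp => //; apply: contra yP; rewrite inE yS.
apply: (flow_delete R IH SL st xy j); [by right | by right |].
move: xS yS; rewrite (joins_crossing _ j) !inE => /andP[/negPf -> _].
by case/andP=> /negPf ->.
Qed.

End Main.

(** * Flows modulo 3 and cuts of size three *)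

Section Modular.

Variables E V : finType.
Implicit Types (h : E -> V * V) (A B S X : {set V}) (p : V * V).
Implicit Types (g : E -> int) (T : V -> int).

Definition flow3 h S : Prop :=
  exists2 g, sign g & {in S, forall v, (3 %| net h g [set v])%Z}.

Lemma feasible_mod3 h S T T' z g0 : {in S, forall v, (3 %| T v - T' v)%Z} ->
  feasible h S T z g0 -> feasible h S T' z g0.
Proof.
move=> TT' [g [sg gT gz]]; exists g; split=> // v vS.
by have := gT v vS; have := TT' v vS; clear; lia.
Qed.

Lemma crossing_fresh h S z e : within h S -> z \notin S -> crossing [set z] (h e) = false.
Proof.
move=> wf zS; have [s1 s2] := wf e; rewrite /crossing !inE.
have nz u : u \in S -> (u == z) = false by move=> uS; apply: contraNF zS => /eqP <-.
by rewrite !nz.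
Qed.

Lemma flow3_feasible h S z g0 : within h S -> z \notin S ->
  flow3 h S <-> feasible h S (fun=> 0) z g0.
Proof.
move=> wf zS; split=> [[g sg g3]|[g [sg g3 _]]].
  exists g; split=> // [v vS|e]; first by rewrite subr0; apply: g3.
  by rewrite (crossing_fresh _ wf zS).
by exists g => // v vS; have := g3 v vS; rewrite subr0.
Qed.

Lemma dist6_three (m : int) (n : nat) : (2 %| m - n%:Z)%Z -> dist6 (3 * m) = dist6 (3 * n%:Z).
Proof. by rewrite /dist6; lia. Qed.

(** The weights are three times the net outflows of an arbitrary direction: they
    vanish modulo 3 and have the right parities. *)
Lemma rooted_flow h S z g0 : within h S -> z \in S -> sign g0 ->
  (3 %| net h g0 [set z])%Z ->
  (deg h [set z] <= 4 + dist6 (3 * (deg h [set z])%:Z))%N ->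
  (forall A, A \subset S :\ z -> A != set0 -> A != S :\ z ->
    (4 + dist6 (3 * (deg h A)%:Z) <= deg h A)%N) ->
  feasible h S (fun=> 0) z g0.
Proof.
move=> wf zS sg z3 zd cut; pose T v : int := 3 * net h (fun=> 1) [set v].
have s1 : sign (fun _ : E => 1) by left.
have wtT A : wt T A = 3 * net h (fun=> 1) A by rewrite net_sum mulr_sumr.
have par A := net_parity h A s1.
apply: (@feasible_mod3 _ _ T); first by move=> v _; rewrite subr0 /T; clear; lia.
apply: (@flow_of_admissible _ _ _ _ _ _ _ z); split => //.
- by move=> A _; rewrite wtT; have := par A; clear; lia.
- rewrite wtT -[X in net _ _ X]setD0 (netD _ wf) ?sub0set // /net big1 // => e _.
  by rewrite /incid !inE subrr mulr0.
- by rewrite /T; move: z3; clear; lia.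
- by rewrite /T (dist6_three (par _)).
by move=> A sA A0 AS; right; rewrite wtT (dist6_three (par _)); apply: cut.
Qed.

(** A root outside the graph imposes no directions. *)
Lemma flow3_lift h S z e1 e2 v x y : within h S -> z \notin S ->
  e1 != e2 -> x != v -> y != v -> joins (h e1) x v -> joins (h e2) y v ->
  flow3 (upd (upd h e1 (x, y)) e2 (y, y)) S -> flow3 h S.
Proof.
move=> wf zS e12 xv yv j1 j2; have [xS vS] := joins_in wf j1; have [yS _] := joins_in wf j2.
have nz u : u \in S -> u != z by move=> uS; apply: contraNneq zS => <-.
move=> F; apply/(flow3_feasible (fun=> 1) wf zS).
apply: (feasible_lift e12 xv yv (nz _ vS) (nz _ yS) j1 j2).
by apply/flow3_feasible => //; do 2![apply: within_upd => //=].
Qed.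

(** A sum of three signs is divisible by 3 only if it is 3 or -3. *)
Lemma three_signs (F : {set E}) (s : E -> int) : #|F| = 3%N -> sign s ->
  (3 %| \sum_(e in F) s e)%Z -> exists2 c : int, c = 1 \/ c = -1 & {in F, forall e, s e = c}.
Proof.
move=> F3 ss; pose N := [set e in F | s e == -1].
have sN : N \subset F by apply/subsetP=> e; rewrite inE => /andP[].
have -> : \sum_(e in F) s e = 3 - 2 * #|N|%:Z.
  have cN : #|N| = (\sum_(e in F) (s e == (-1)%R))%N.
    rewrite -sum1dep_card big_mkcondr; apply: eq_bigr => e _.
    by case: (s e == -1).
  have -> : 3 = #|F|%:Z by rewrite F3.
  rewrite cN -sum1_card !(big_morph Posz PoszD (erefl _)) mulr_sumr -sumrB.
  by apply: eq_bigr => e _; case: (ss e) => ->.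
have := subset_leq_card sN; rewrite F3 => le3 d3.
have : (#|N| == 0%N) || (#|N| == 3%N) by move: le3 d3; clear; lia.
case/orP=> [|N3].
  rewrite cards_eq0 => /eqP N0; exists 1; first by left.
  move=> e eF; case: (ss e) => // se.
  by have : e \in N; [rewrite inE eF se | rewrite N0 inE].
exists (-1); first by right.
have NF : N = F by apply/eqP; rewrite eqEcard sN F3 (eqP N3).
by move=> e; rewrite -NF inE => /andP[_ /eqP].
Qed.

Lemma cut3_signs h A g : sign g -> deg h A = 3%N -> (3 %| net h g A)%Z ->
  exists2 c : int, c = 1 \/ c = -1 & forall e, crossing A (h e) -> g e = c * incid A (h e).
Proof.
move=> sg; rewrite degE => F3 n3.
pose s e : int := if crossing A (h e) then g e * incid A (h e) else 1.
have inc e : crossing A (h e) -> incid A (h e) = 1 \/ incid A (h e) = -1.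
  by rewrite /crossing /incid; case: (_ \in A); case: (_ \in A) => //= _; [left|right].
have ss : sign s.
  move=> e; rewrite /s; case: ifP => [/inc|_]; last by left.
  by case=> ->; case: (sg e) => ->; [left|right|right|left].
have [|c c1 sc] := three_signs F3 ss.
  have <- // : net h g A = \sum_(e in [set e | crossing A (h e)]) s e.
  rewrite [RHS]big_mkcond; apply: eq_bigr => e _; rewrite inE /s.
  by case: ifP => [-> //|]; rewrite /crossing /incid => /negbFE/eqP ->; rewrite subrr mulr0.
exists c => // e ce; rewrite -(sc e) ?inE // /s ce.
by case: (inc e ce) => ->; clear; lia.
Qed.

(** On a cut of size 3 both flows are constant up to sign, so one of them can be
    reversed to match the other. *)
Lemma flow3_cut3 h S z A r q : within h S -> z \notin S -> A \subset S -> r \in A ->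
  q \in S :\: A -> deg h A = 3%N ->
  flow3 (relabel (collapse A r) h) (collapse A r @: S) ->
  flow3 (relabel (collapse (S :\: A) q) h) (collapse (S :\: A) q @: S) ->
  flow3 h S.
Proof.
move=> wf zS AS rA qD d3 F1 [g2 sg2 n2].
have zA : z \notin A by apply: contra zS; apply: (subsetP AS).
have sub B b : B \subset S -> b \in B -> collapse B b @: S \subset S.
  by move=> BS bB; rewrite imset_collapse // subUset sub1set (subsetP BS) //= subsetDl.
have push0 phi v : push phi S (fun=> 0) v = 0 by rewrite /push big1.
apply/(flow3_feasible (fun=> 1) wf zS).
apply: (feasible_glue wf AS rA qD zA).
  apply: (@feasible_mod3 _ _ (fun=> 0)); first by move=> v _; rewrite push0.
  apply/flow3_feasible => //; first exact: within_relabel.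
  by apply: contra zS; apply: (subsetP (sub _ _ AS rA)).
move=> g1 sg1; rewrite /wt big1 // subr0 => n1.
have DS : S :\: A \subset S := subsetDl _ _.
have qI : q \in collapse (S :\: A) q @: S by rewrite imset_collapse // setU11.
have n2q : (3 %| net h g2 A)%Z.
  have := n2 q qI; rewrite (net_relabel _ _ _ wf) pre_collapse // (netD _ wf) //.
  by clear; lia.
have [c1 c1s e1] := cut3_signs sg1 d3 n1.
have [c2 c2s e2] := cut3_signs sg2 d3 n2q.
apply: (@feasible_mod3 _ _ (fun=> 0)); first by move=> v _; rewrite push0.
exists (fun e => c1 * c2 * g2 e); split.
- move=> e; case: c1s => ->; case: c2s => ->; case: (sg2 e) => ->;
  by [left | right].
- move=> v vS; have := n2 v vS; rewrite subr0.
  have -> : net (relabel (collapse (S :\: A) q) h) (fun e => c1 * c2 * g2 e) [set v] =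
     c1 * c2 * net (relabel (collapse (S :\: A) q) h) g2 [set v].
    by rewrite /net mulr_sumr; apply: eq_bigr => e _; rewrite mulrA.
  by move: (net _ _ _) => n; case: c1s => ->; case: c2s => ->; clear; lia.
- move=> e; rewrite (crossing_relabel _ _ _ wf) pre_collapse // (crossingD _ wf) // => ce.
  by rewrite (e1 e ce) (e2 e ce); case: c1s => ->; case: c2s => ->; clear; lia.
Qed.

Lemma deg_sum h A : (\sum_(v in A) deg h [set v])%N =
  (deg h A + #|[set e | [&& (h e).1 \in A, (h e).2 \in A & (h e).1 != (h e).2]]|.*2)%N.
Proof.
rewrite /deg exchange_big /= -sum1dep_card [X in X.*2]big_mkcond /= -mul2n big_distrr /= -big_split /=.
apply: eq_bigr => e _; rewrite /crossing; case: (h e) => a b /=.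
have one c : (\sum_(v in A) (c == v) = (c \in A))%N.
  case: (boolP (c \in A)) => cA.
    by rewrite (bigD1 c) //= eqxx big1 // => i /andP[_]; rewrite eq_sym => /negPf ->.
  by rewrite big1 // => i iA; case: eqP => // ci; rewrite ci iA in cA.
case: (a =P b) => [->|/eqP ab].
  by rewrite big1 => [|v _]; rewrite !eqxx // !andbF.
rewrite (eq_bigr (fun v => (a == v) + (b == v))%N) => [|v _]; last first.
  rewrite !inE; case: (a =P v) => [av|_]; case: (b =P v) => [bv|_] //.
  by rewrite av bv eqxx in ab.
rewrite big_split /= !one.
by do 2!case: (_ \in A).
Qed.

End Modular.

(** * Merging the cubic vertices into a root *)

Section FewCubic.

Variables E V : finType.
Implicit Types (h : E -> V * V) (A B S X : {set V}) (p : V * V).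
Implicit Types (g : E -> int) (T eps : V -> int).

(** [X] consists of the cubic vertices.  Sets avoiding [X] satisfy the cut condition
    for outflows 0; the complement of a cubic vertex has three boundary edges and
    must be exempt when [X] is a singleton.  The vertex [z] is reserved for the
    root. *)
Record few_cubic h S X z : Prop := FewCubic {
  fc_within : within h S;
  fc_fresh : z \notin S;
  fc_sub : X \subset S;
  fc_card : (#|X| <= 3)%N;
  fc_deg : {in X, forall x, deg h [set x] = 3%N};
  fc_cut : forall A, A \subset S -> A != set0 -> A != S -> [disjoint A & X] ->
    (forall x, x \in X -> A != S :\ x) ->
    (4 + dist6 (3 * (deg h A)%:Z) <= deg h A)%N;
  fc_bridge : forall A, A \subset S -> deg h A != 1%N }.

(** The cubic vertex [x] is a source if [eps x] is 1 and a sink if it is -1. *)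
Definition root_signs h X eps : E -> int := fun e =>
  if (h e).1 \in X then eps (h e).1 else if (h e).2 \in X then - eps (h e).2 else 1.

(** Adjacent cubic vertices cannot be both sources or both sinks. *)
Definition opposite h X eps := forall e x y, x \in X -> y \in X -> x != y ->
  joins (h e) x y -> eps x = - eps y.

Definition merge z X : V -> V := collapse (z |: X) z.

Section Merge.

Variables (h : E -> V * V) (S X : {set V}) (z : V) (eps : V -> int).
Hypothesis FC : few_cubic h S X z.
Hypothesis eps_sign : forall v, eps v = 1 \/ eps v = -1.
Hypothesis eps_opp : opposite h X eps.

Let g0 := root_signs h X eps.
Let hX := relabel (merge z X) h.
Let Sz := z |: S.
Let S' := z |: (S :\: X).

Lemma merge_within : within h Sz.
Proof. by move=> e; have [s1 s2] := fc_within FC e; rewrite !inE s1 s2 !orbT. Qed.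

Lemma merge_imset : merge z X @: Sz = S'.
Proof.
rewrite /merge imset_collapse ?setU11 ?setUS ?(fc_sub FC) //.
by apply/setP=> v; rewrite !inE; case: (v == z) => //=; case: (v \in X).
Qed.

Lemma merge_within' : within hX S'.
Proof. by rewrite -merge_imset; apply: within_relabel merge_within. Qed.

Lemma neq_fresh v : v \in S -> (v == z) = false.
Proof. by move=> vS; apply: contraNF (fc_fresh FC) => /eqP <-. Qed.

Lemma deg_merge A : A \subset S :\: X -> deg hX A = deg h A.
Proof.
move=> sA; apply: eq_bigr => e _; have [s1 s2] := fc_within FC e.
have zA : (z \in A) = false.
  by apply: contraNF (fc_fresh FC) => /(subsetP sA); rewrite inE => /andP[].
have mA u : u \in S -> (merge z X u \in A) = (u \in A).
  move=> uS; rewrite /merge /collapse !inE (neq_fresh uS) /=.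
  case: (boolP (u \in X)) => // uX; rewrite zA.
  by apply/esym/negP=> /(subsetP sA); rewrite inE uX.
by rewrite /crossing /hX /relabel /= !mA.
Qed.

Lemma incid_merge e : incid [set z] (hX e) = incid X (h e).
Proof.
have [s1 s2] := fc_within FC e.
have mz u : u \in S -> (merge z X u == z) = (u \in X).
  move=> uS; rewrite /merge /collapse !inE (neq_fresh uS) /=.
  by case: ifP => //; rewrite ?eqxx // neq_fresh.
by rewrite /incid /hX /relabel /= !inE !mz.
Qed.

Lemma crossing_merge e : crossing [set z] (hX e) = crossing X (h e).
Proof.
have := incid_merge e; rewrite /incid /crossing.
by do 4!case: (_ \in _).
Qed.

Lemma root_signs_sign : sign g0.
Proof.
move=> e; rewrite /g0 /root_signs; case: ifP => // _; case: ifP => _; last by left.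
by case: (eps_sign (h e).2) => ->; [right | left].
Qed.

Lemma root_signs_incid e x : x \in X -> crossing [set x] (h e) -> 
  g0 e * incid [set x] (h e) = eps x.
Proof.
move=> xX /crossing_end[w wx j]; rewrite joinsC in j.
have xw : x != w by rewrite eq_sym.
rewrite (joins_incid _ xw j) !inE eqxx (negPf wx).
move: (j); rewrite /g0 /root_signs /leaving /joins => /orP[] /eqP -> /=.
  by rewrite xX eqxx; clear; lia.
rewrite (negPf wx); case: ifP => [wX|_]; last by rewrite xX; clear; lia.
by rewrite (eps_opp xX wX xw j); clear; lia.
Qed.

Lemma net_of_leaving g x : (forall e, crossing [set x] (h e) ->
  g e * incid [set x] (h e) = eps x) -> net h g [set x] = eps x * (deg h [set x])%:Z.
Proof.
move=> H; rewrite /deg (big_morph Posz PoszD (erefl _)) mulr_sumr.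
apply: eq_bigr => e _; case: (boolP (crossing [set x] (h e))) => ce.
  by rewrite H // mulr1.
by move: ce; rewrite /crossing /incid => /negPn/eqP ->; rewrite subrr !mulr0.
Qed.

Lemma root_signs_net : (3 %| net hX g0 [set z])%Z.
Proof.
have -> : net hX g0 [set z] = net h g0 X.
  by apply: eq_bigr => e _; rewrite incid_merge.
rewrite net_sum; apply: (big_ind (fun x => 3 %| x)%Z) => // [a b|x xX]; first lia.
rewrite net_of_leaving ?(fc_deg FC) //; first lia.
by move=> e; apply: root_signs_incid.
Qed.

(** Edges inside [X] become loops at the root and get back the signs given by
    [eps]; each cubic vertex then has net outflow 3 or -3. *)
Lemma merge_flow : feasible hX S' (fun=> 0) z g0 -> flow3 h S.
Proof.
case=> g [sg g3 gz].
pose g' e := if ((h e).1 \in X) && ((h e).2 \in X) then g0 e else g e.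
exists g'; first by move=> e; rewrite /g'; case: ifP => // _; apply: root_signs_sign.
have gX e : ((h e).1 \in X) || ((h e).2 \in X) -> g' e = g0 e.
  rewrite /g' => eX; case: ifP => // nX; apply: gz.
  by rewrite crossing_merge /crossing; move: eX nX; do 2!case: (_ \in X).
move=> v vS; case: (boolP (v \in X)) => vX.
  rewrite net_of_leaving ?(fc_deg FC) //; first lia.
  move=> e ce; rewrite gX ?root_signs_incid //.
  have [w _] := crossing_end ce; rewrite /joins => /orP[] /eqP -> /=; by rewrite vX ?orbT.
have vI : v \in S' by rewrite !inE vS vX orbT.
have := g3 v vI; rewrite subr0 (net_relabel _ _ _ merge_within) /merge pre_collapse1.
- congr (is_true (_ %| _)%Z); apply: eq_bigr => e _; rewrite /g'; case: ifP => // /andP[e1 e2].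
  by rewrite /incid !inE; do 2![case: eqP => [ev|_]; first by rewrite -ev ?e1 ?e2 in vX]; rewrite !mulr0.
- exact: setU11.
- by rewrite !inE (negPf vX) vS (neq_fresh vS) orbT.
Qed.

Lemma merge_sub A : A \subset S' :\ z -> A \subset S :\: X.
Proof.
by move=> sA; apply/subsetP=> u /(subsetP sA); rewrite !inE; case: eqP.
Qed.

Lemma fc_cut_merged A : A \subset S :\: X -> A != set0 -> A != S :\: X ->
  (4 + dist6 (3 * (deg h A)%:Z) <= deg h A)%N.
Proof.
move=> sA A0 AS; apply: (fc_cut FC) => //.
- by apply: subset_trans sA (subsetDl _ _).
- apply: contra_neq AS => AE; apply/eqP; rewrite eqEsubset sA AE.
  exact: subsetDl.
- rewrite -setI_eq0 -subset0; apply/subsetP=> u; rewrite inE => /andP[/(subsetP sA)].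
  by rewrite inE => /andP[/negPf ->].
move=> x xX; apply: contra_neq AS => AE; apply/eqP; rewrite eqEsubset sA /= AE.
by apply/subsetP=> u; rewrite !inE => /andP[uX ->]; rewrite andbT; apply: contraNneq uX => ->.
Qed.

Lemma merge_rooted : (deg h X <= 4 + dist6 (3 * (deg h X)%:Z))%N -> flow3 h S.
Proof.
have dz : deg hX [set z] = deg h X.
  by apply: eq_bigr => e _; rewrite crossing_merge.
move=> dX; apply: merge_flow; apply: rooted_flow; rewrite ?dz //.
- exact: merge_within'.
- exact: setU11.
- exact: root_signs_sign.
- exact: root_signs_net.
move=> A sA A0 AS; have sA' := merge_sub sA.
rewrite (deg_merge sA'); apply: fc_cut_merged => //.
apply: contra_neq AS => ->; rewrite setU1K // !inE.
by rewrite (negPf (fc_fresh FC)) andbF.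
Qed.

(** Deleting an arc from the source [x1] to [y] and an arc from [y'] to the sink
    [x2] leaves the weight of the root unchanged and lowers its degree by 2, to 4
    or 7.  A neighbour of odd degree has weight 3, which moves closer to a multiple
    of 6 in either direction; one of even degree at least 6 has an edge to spare. *)
Lemma merge_deleted e1 e2 x1 x2 y y' : x1 \in X -> x2 \in X ->
  y \in S :\: X -> y' \in S :\: X ->
  joins (h e1) x1 y -> joins (h e2) x2 y' -> eps x1 = 1 -> eps x2 = -1 ->
  deg h X = 6%N \/ deg h X = 9%N ->
  (forall A, A \subset S :\: X -> (1 < #|A|)%N -> A != S :\: X ->
    (6 + dist6 (3 * (deg h A)%:Z) <= deg h A)%N) ->
  (y != y' /\ (deg h [set y] != 4%N) /\ (deg h [set y'] != 4%N)) \/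
  (y = y' /\ (deg h [set y] != 4%N) /\ deg h [set y] != 7%N) ->
  flow3 h S.
Proof.
move=> x1X x2X yD y'D j1 j2 eps1 eps2 dX SL yy'.
have := yD; have := y'D; rewrite !inE => /andP[y'X y'S] /andP[yX yS].
have dz : deg hX [set z] = deg h X.
  by apply: eq_bigr => e _; rewrite crossing_merge.
have mX u : u \in X -> merge z X u = z.
  by move=> uX; rewrite /merge /collapse !inE uX orbT.
have mY u : u \in S -> u \notin X -> merge z X u = u.
  by move=> uS uX; rewrite /merge /collapse !inE (negPf uX) (neq_fresh uS).
have jm e a b : joins (h e) a b -> joins (hX e) (merge z X a) (merge z X b).
  by rewrite /joins /hX /relabel => /orP[] /eqP -> /=; rewrite eqxx ?orbT.
have J1 : joins (hX e1) z y by have := jm _ _ _ j1; rewrite mX // mY.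
have J2 : joins (hX e2) y' z by have := jm _ _ _ j2; rewrite mX // mY // joinsC.
have zy : z != y by rewrite eq_sym neq_fresh.
have y'z : y' != z by rewrite neq_fresh.
have ends e x w : joins (h e) x w -> x \in X -> w \notin X ->
    g0 e = eps x * leaving (hX e) z.
  move=> j xX wX; have [xS' wS] := joins_in (fc_within FC) j.
  move: j; rewrite /joins /g0 /root_signs /leaving /hX /relabel => /orP[] /eqP -> /=.
    by rewrite xX mX // eqxx mulr1.
  by rewrite (negPf wX) xX mY // neq_fresh // mulrN1.
have G1 : g0 e1 = leaving (hX e1) z by rewrite (ends _ _ _ j1 x1X yX) eps1 mul1r.
have G2 : g0 e2 = leaving (hX e2) y'.
  by rewrite (ends _ _ _ j2 x2X y'X) eps2 mulN1r (leavingC y'z J2) opprK.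
have e21 : e2 != e1.
  have x12 : x1 != x2 by apply/eqP=> x12; move: eps1; rewrite x12 eps2.
  apply/eqP=> ee; move: j1 j2; rewrite ee /joins.
  case/orP=> /eqP -> /orP[] /eqP [] a b.
  - by rewrite a eqxx in x12.
  - by rewrite -a x1X in y'X.
  - by rewrite a x2X in yX.
  - by rewrite b eqxx in x12.
have s1 : sign (fun _ : E => 1) by left.
pose T0 v : int := 3 * net hX (fun=> 1) [set v].
have wtT0 A : wt T0 A = 3 * net hX (fun=> 1) A by rewrite [in RHS]net_sum mulr_sumr.
have par A := net_parity hX A s1.
apply: merge_flow; apply: (@feasible_mod3 _ _ _ _ T0).
  by move=> v _; rewrite subr0 /T0; clear; lia.
apply: (feasible_del zy J1) => //.
have J2' : joins (upd hX e1 (z, z) e2) y' z by rewrite upd_neq.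
apply: (feasible_del y'z J2'); first by rewrite upd_neq.
set h'' := upd _ e2 _; set T := bump _ z 1.
have wtT A : wt T A = wt T0 A + (y \in A)%:Z - (y' \in A)%:Z.
  by rewrite /T !wt_bump; clear; lia.
have degT A : (deg h'' A + ((y \in A) != (z \in A)) + ((y' \in A) != (z \in A)) = deg hX A)%N.
  have := deg_upd (upd hX e1 (z, z)) e2 (y', y') A; have := deg_upd hX e1 (z, z) A.
  rewrite -/h'' (upd_neq _ _ e21) (joins_crossing _ J1) (joins_crossing _ J2).
  rewrite /crossing /= !eqxx /=; move: (deg h'' A) (deg (upd hX e1 (z, z)) A) (deg hX A).
  by clear; do 3!case: (_ \in A) => /=; lia.
have wf' := merge_within'.
have Tz : T z = T0 z.
  have := wtT [set z]; rewrite !wt1 !inE (negPf y'z) [y == z]eq_sym (negPf zy).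
  by clear; lia.
have zS' : z \in S' by exact: setU11.
have yS' : y \in S' by rewrite !inE yX yS orbT.
have y'S' : y' \in S' by rewrite !inE y'X y'S orbT.
apply: (@flow_of_admissible _ _ _ _ _ _ _ z); split => //.
- by apply: within_upd => //; apply: within_upd.
- exact: root_signs_sign.
- move=> A AS; have := degT A; have := par A; rewrite wtT wtT0.
  move: (deg h'' A) (deg hX A) (net _ _ _); clear.
  by do 3!case: (_ \in A) => /=; lia.
- rewrite wtT wtT0 yS' y'S' -[X in net _ _ X]setD0 (netD _ wf') ?sub0set // /net big1.
    by clear; lia.
  by move=> e _; rewrite /incid !inE subrr mulr0.
- rewrite Tz; have -> : net h'' g0 [set z] = net hX g0 [set z].
    rewrite /h'' !net_upd (upd_neq _ _ e21) (joins_incid _ zy J1) (joins_incid _ y'z J2).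
    rewrite G1 G2 /incid /= !inE !eqxx (negPf y'z) [y == z]eq_sym (negPf zy).
    by case: (leaving_sign (hX e1) z) => ->; case: (leaving_sign (hX e2) y') => ->; clear; lia.
  by have := root_signs_net; rewrite /T0; clear; lia.
- rewrite Tz.
  have := degT [set z]; rewrite !inE eqxx (negPf y'z) [y == z]eq_sym (negPf zy) /= dz.
  rewrite /T0 (dist6_three (par _)) dz.
  by move: (deg h'' _) => d; case: dX => ->; rewrite /dist6; clear; lia.
move=> A sA A0 AS; right; have sA' := merge_sub sA.
have AS' : A != S :\: X.
  apply: contra_neq AS => ->; rewrite setU1K // !inE.
  by rewrite (negPf (fc_fresh FC)) andbF.
have := degT A; rewrite wtT wtT0 (root_notin sA).
have cA := fc_cut_merged sA' A0 AS'; have pA := par A; rewrite (deg_merge sA') in pA *.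
case: (set1_or_large A0) => [[w Aw]|A1]; last first.
  have := SL A sA' A1 AS'; move: pA.
  move: (deg h'' A) (deg h A) (net _ _ _); clear; rewrite /dist6.
  by do 2!case: (_ \in A) => /=; lia.
move: cA pA; rewrite Aw !inE.
case: yy' => [[yy' [dy dy']]|[yy' [d4 d7]]].
  case: (y =P w) => [yw|_]; case: (y' =P w) => [y'w|_] /=.
  - by move: yy'; rewrite yw y'w eqxx.
  - move: dy; rewrite yw; move: (deg h'' _) (deg h _) (net _ _ _); clear; rewrite /dist6; lia.
  - move: dy'; rewrite y'w; move: (deg h'' _) (deg h _) (net _ _ _); clear; rewrite /dist6; lia.
  - move: (deg h'' _) (deg h _) (net _ _ _); clear; rewrite /dist6; lia.
rewrite -yy'; case: (y =P w) => [yw|_] /=.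
  move: d4 d7; rewrite yw; move: (deg h'' _) (deg h _) (net _ _ _); clear; rewrite /dist6; lia.
move: (deg h'' _) (deg h _) (net _ _ _); clear; rewrite /dist6; lia.
Qed.

End Merge.

End FewCubic.

(** * Reductions with at most three cubic vertices *)

Section FewCubicReductions.

Variables E V : finType.
Implicit Types (h : E -> V * V) (A B S X : {set V}) (p : V * V).
Implicit Types (g : E -> int) (T eps : V -> int).

Definition smaller_cubic n z := forall h S X,
  few_cubic h S X z -> (#|S| < n)%N -> flow3 h S.

Lemma pre_id S A r (A' : {set V}) : A' \subset collapse A r @: S -> r \in A ->
  A \subset S -> r \notin A' -> pre (collapse A r) S A' = A'.
Proof.
move=> sA' rA AS rA'; apply/setP=> u; rewrite inE /collapse; case: (boolP (u \in A)) => uA.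
  rewrite (negPf rA') andbF; apply/esym/negP=> uA'.
  have := subsetP sA' u uA'; rewrite imset_collapse // !inE uA /= orbF => /eqP ur.
  by rewrite -ur uA' in rA'.
apply: andb_idl => uA'; have := subsetP sA' u uA'; rewrite imset_collapse // !inE.
by case/orP=> [/eqP ->|/andP[]//]; apply: (subsetP AS).
Qed.

Lemma pre_neq phi S (A' : {set V}) : A' \subset phi @: S ->
  (A' != set0 -> pre phi S A' != set0) /\ (A' != phi @: S -> pre phi S A' != S).
Proof.
move=> sA'; split.
  by apply: contra_neq => p0; rewrite -(image_pre sA') p0 imset0.
by apply: contra_neq => pS; rewrite -(image_pre sA') pS.
Qed.

Lemma fresh_collapse S A r z : A \subset S -> r \in A -> z \notin S ->
  z \notin collapse A r @: S.
Proof.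
move=> AS rA; apply: contra; rewrite imset_collapse // !inE.
by case/orP=> [/eqP ->|/andP[]//]; apply: (subsetP AS).
Qed.

Lemma disjoint_in A B u : [disjoint A & B] -> u \in A -> u \in B -> False.
Proof. by rewrite -setI_eq0 => /eqP /setP /(_ u) H uA uB; move: H; rewrite !inE uA uB. Qed.

Lemma disjointI A B : (forall u, u \in A -> u \in B -> False) -> [disjoint A & B].
Proof.
move=> H; rewrite -setI_eq0 -subset0; apply/subsetP=> u; rewrite inE => /andP[uA uB].
by case: (H u uA uB).
Qed.

Lemma card_gt1_other X x : (1 < #|X|)%N -> exists2 x', x' \in X & x' != x.
Proof.
move=> X2; have /card_gt0P[x'] : (0 < #|X :\ x|)%N.
  by have := cardsD1 x X; move: X2; case: (x \in X); clear; lia.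
by rewrite !inE => /andP[x'x x'X]; exists x'.
Qed.

Lemma fc_cut_disjoint h S X z A : few_cubic h S X z -> (1 < #|X|)%N ->
  A \subset S -> A != set0 -> [disjoint A & X] ->
  (4 + dist6 (3 * (deg h A)%:Z) <= deg h A)%N.
Proof.
move=> FC X2 AS A0 AX; have XS := fc_sub FC; apply: (fc_cut FC) => //.
  have /card_gt0P[x xX] := ltnW X2.
  by apply/eqP=> AE; apply: (disjoint_in AX _ xX); rewrite AE (subsetP XS).
move=> x xX; have [x' x'X x'x] := card_gt1_other x X2.
by apply/eqP=> AE; apply: (disjoint_in AX _ x'X); rewrite AE !inE x'x (subsetP XS).
Qed.

(** A set of at least two vertices avoiding [X] with boundary 4 or 7 is contracted;
    its complement is then a legal root for the inside. *)
Lemma fc_slack h S X z A : few_cubic h S X z -> smaller_cubic #|S| z -> (1 < #|X|)%N ->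
  A \subset S -> (1 < #|A|)%N -> A != S -> [disjoint A & X] ->
  flow3 h S \/ (6 + dist6 (3 * (deg h A)%:Z) <= deg h A)%N.
Proof.
move=> FC IH X2 AS A1 AnS AX; have [wf zS XS X3 dX cut br] := FC.
case: (leqP (6 + dist6 (3 * (deg h A)%:Z)) (deg h A)) => [|dA]; [by right|left].
have A0 : A != set0 by rewrite -card_gt0; apply: ltnW.
have dA' := fc_cut_disjoint FC X2 AS A0 AX.
have {dA dA'}dA : deg h A = 4%N \/ deg h A = 7%N.
  by move: dA dA'; rewrite /dist6; clear; lia.
have [r rA] : exists r, r \in A by apply/card_gt0P; apply: ltnW.
have [q qD] : exists q, q \in S :\: A.
  apply/card_gt0P; rewrite card_gt0; apply: contra_neq AnS => D0; apply/eqP.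
  by rewrite eqEsubset AS -setD_eq0 D0 eqxx.
have zA : z \notin A by apply: contra zS; apply: (subsetP AS).
have push0 phi v : push phi S (fun=> 0) v = 0 by rewrite /push big1.
apply/(flow3_feasible (fun=> 1) wf zS).
apply: (feasible_glue wf AS rA qD zA).
  apply: (@feasible_mod3 _ _ _ _ (fun=> 0)); first by move=> v _; rewrite push0.
  apply/flow3_feasible; [exact: within_relabel | exact: fresh_collapse |].
  apply: (IH _ _ X); last exact: card_collapse.
  have XD x : x \in X -> x \in S :\: A.
    move=> xX; rewrite inE (subsetP XS) // andbT; apply/negP=> xA.
    exact: disjoint_in AX xA xX.
  split => //.
  - exact: within_relabel.
  - exact: fresh_collapse.
  - by apply/subsetP=> x /XD xD; rewrite imset_collapse // inE xD orbT.
  - by move=> x xX; rewrite (deg_relabel _ _ wf) pre_collapse1 ?XD // dX.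
  - move=> A' sA' A'0 _ A'X _; rewrite (deg_relabel _ _ wf).
    have [n0 _] := pre_neq sA'.
    have pX : [disjoint pre (collapse A r) S A' & X].
      apply: disjointI => u; rewrite inE => /andP[_ uA'] uX.
      move: uA'; rewrite /collapse; have := XD u uX; rewrite inE => /andP[/negPf -> _].
      by move=> uA'; exact: disjoint_in A'X uA' uX.
    by apply: (fc_cut_disjoint FC X2 (pre_sub _ _ _) (n0 A'0) pX).
  - by move=> A' sA'; rewrite (deg_relabel _ _ wf); apply: br; apply: pre_sub.
move=> g1 sg1; rewrite /wt big1 // subr0 => n1.
have DS : S :\: A \subset S := subsetDl _ _.
apply: (@feasible_mod3 _ _ _ _ (fun=> 0)); first by move=> v _; rewrite push0.
apply: rooted_flow => //.
- exact: within_relabel.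
- by rewrite imset_collapse // setU11.
- rewrite (net_relabel _ _ _ wf) pre_collapse // (netD _ wf) //.
  by move: n1; clear; lia.
- rewrite (deg_relabel _ _ wf) pre_collapse // (degD wf) //.
  by case: dA => ->.
move=> A' sA' A'0 A'S; rewrite (deg_relabel _ _ wf).
have sA'I : A' \subset collapse (S :\: A) q @: S by apply: subset_trans sA' (subsetDl _ _).
rewrite (pre_id sA'I) //; last by apply/negP=> /(subsetP sA'); rewrite !inE eqxx.
have A'A : A' \subset A.
  apply/subsetP=> u /(subsetP sA'); rewrite imset_collapse // !inE.
  by case/andP=> /negPf -> /=; case: (u \in A); case: (u \in S).
have A'X : [disjoint A' & X].
  by apply: disjointI => u uA' uX; apply: (disjoint_in AX _ uX); apply: (subsetP A'A).
exact: (fc_cut_disjoint FC X2 (subset_trans A'A AS) A'0 A'X).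
Qed.

(** Both sides of the cut contain a cubic vertex, so after contracting a side, and
    counting the new vertex as cubic, there are still at most three of them. *)
Lemma fc_cut3 h S X z A : few_cubic h S X z -> smaller_cubic #|S| z ->
  A \subset S -> (1 < #|A|)%N -> (1 < #|S :\: A|)%N -> deg h A = 3%N -> flow3 h S.
Proof.
move=> FC IH; have [wf zS XS X3 dX cut br] := FC.
have meets B : B \subset S -> (1 < #|B|)%N -> (1 < #|S :\: B|)%N -> deg h B = 3%N ->
    (0 < #|B :&: X|)%N.
  move=> BS B1 D1 d3; rewrite card_gt0 setI_eq0; apply/negP=> BX.
  have := cut B BS _ _ BX; rewrite d3 -card_gt0 (ltnW B1) => /(_ isT).
  suff [H1 H2] : B != S /\ forall x, x \in X -> B != S :\ x by move=> /(_ H1 H2).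
  split; first by apply: contraTneq D1 => ->; rewrite setDv cards0.
  move=> x xX; apply: contraTneq D1 => ->.
  rewrite setDDr setDv set0U -leqNgt; apply: leq_trans (subset_leq_card (subsetIr _ _)) _.
  by rewrite cards1.
have side B r : B \subset S -> (1 < #|B|)%N -> (1 < #|S :\: B|)%N -> deg h B = 3%N ->
    r \in B -> flow3 (relabel (collapse B r) h) (collapse B r @: S).
  move=> BS B1 D1 d3 rB; have BX := meets B BS B1 D1 d3.
  apply: (IH _ _ (r |: (X :\: B))); last exact: card_collapse.
  split.
  - exact: within_relabel.
  - exact: fresh_collapse.
  - by rewrite imset_collapse //; apply: setUS; apply: setSD.
  - have := cardsID B X; rewrite setIC => cX; rewrite cardsU1 !inE rB /=.
    by move: X3 BX cX; clear; lia.
  - move=> x; rewrite !inE (deg_relabel _ _ wf) => /orP[/eqP ->|/andP[xB xX]].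
      by rewrite pre_collapse.
    by rewrite pre_collapse1 ?dX // inE xB (subsetP XS).
  - move=> A' sA' A'0 A'S A'X _; rewrite (deg_relabel _ _ wf).
    have [n0 nS] := pre_neq sA'; have rA' : r \notin A'.
      by apply/negP=> rA'; apply: (disjoint_in A'X rA'); rewrite setU11.
    have pA' := pre_id sA' rB BS rA'.
    have notB u : u \in A' -> u \notin B.
      move=> uA'; have := subsetP sA' u uA'; rewrite imset_collapse // !inE.
      by case/orP=> [/eqP ur|/andP[]//]; rewrite -ur uA' in rA'.
    apply: cut; [exact: pre_sub | exact: n0 | exact: nS | |].
      rewrite pA'; apply: disjointI => u uA' uX; apply: (disjoint_in A'X uA').
      by rewrite !inE (notB u uA') uX orbT.
    move=> x xX; rewrite pA'; apply/eqP=> A'E.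
    have /card_gt0P[b] : (0 < #|B :\ x|)%N.
      by have := cardsD1 x B; move: B1; case: (x \in B); clear; lia.
    rewrite !inE => /andP[bx bB]; have := notB b; rewrite A'E !inE bx bB (subsetP BS) //.
    by move=> /(_ isT).
  - by move=> A' sA'; rewrite (deg_relabel _ _ wf); apply: br; apply: pre_sub.
move=> AS A1 D1 d3.
have [r rA] : exists r, r \in A by apply/card_gt0P; apply: ltnW.
have [q qD] : exists q, q \in S :\: A by apply/card_gt0P; apply: ltnW.
apply: (flow3_cut3 wf zS AS rA qD d3); apply: side => //; first exact: subsetDl.
- by rewrite setDDr setDv set0U (setIidPr AS).
- by rewrite (degD wf).
Qed.

Lemma flow3_isolated h S u v : within h S -> v \in S -> u \in S -> u != v ->
  deg h [set v] = 0%N ->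
  flow3 (relabel (collapse [set v; u] u) h) (S :\ v) -> flow3 h S.
Proof.
move=> wf vS uS uv dv [g sg g3]; exists g => // w wS.
have netv : net h g [set v] = 0.
  rewrite /net big1 // => e _; move: dv; rewrite /deg (bigD1 e) //= => dv.
  have /negPn/eqP ce : ~~ crossing [set v] (h e) by move: dv; case: crossing.
  by rewrite /incid ce subrr mulr0.
have AS : [set v; u] \subset S by apply/subsetP=> a; rewrite !inE => /orP[] /eqP ->.
have uA : u \in [set v; u] by rewrite !inE eqxx orbT.
case: (w =P v) => [->|/eqP wv]; first by rewrite netv.
have wI : w \in S :\ v by rewrite !inE wv.
have := g3 w wI; rewrite (net_relabel _ _ _ wf).
case: (w =P u) => [->|/eqP wu].
  by rewrite pre_collapse // net_pair 1?eq_sym // netv add0r.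
by rewrite pre_collapse1 // !inE (negPf wv) (negPf wu).
Qed.

Lemma deg_isolated h S u v A : within h S -> u != v -> deg h [set v] = 0%N ->
  v \notin A -> deg (relabel (collapse [set v; u] u) h) A = deg h A.
Proof.
move=> wf uv dv vA; apply: eq_bigr => e _.
have : ~~ crossing [set v] (h e).
  by move: dv; rewrite /deg (bigD1 e) //=; case: crossing.
have cv w : w != v -> collapse [set v; u] u w = w.
  by rewrite /collapse !inE => /negPf -> /=; case: eqP.
rewrite /crossing !inE negbK /relabel /= => /eqP.
case: ((h e).1 =P v) => [-> /esym/eqP ->|/eqP n1 /esym/negbT n2]; first by rewrite !eqxx.
by rewrite !cv.
Qed.

End FewCubicReductions.

(** * Adjacent cubic vertices *)

Section FewCubicFlow.

Variables E V : finType.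
Implicit Types (h : E -> V * V) (A B S X : {set V}) (p : V * V).
Implicit Types (g : E -> int) (T eps : V -> int).

Definition inner h A : {set E} :=
  [set e | [&& (h e).1 \in A, (h e).2 \in A & (h e).1 != (h e).2]].

Lemma deg_cubic_set h S X z : few_cubic h S X z ->
  (3 * #|X| = deg h X + #|inner h X|.*2)%N.
Proof.
move=> FC; rewrite -deg_sum (eq_bigr (fun=> 3%N)); last exact: fc_deg FC.
by rewrite sum_nat_const mulnC.
Qed.

Lemma inner_joins h A e x y : x \in A -> y \in A -> x != y -> joins (h e) x y -> e \in inner h A.
Proof.
by move=> xA yA xy; rewrite inE => /orP[] /eqP -> /=; rewrite xA yA // eq_sym.
Qed.

(** A root of degree 0 or 3 is always legal. *)
Lemma few_cubic_small h S X z : few_cubic h S X z -> (#|X| <= 1)%N -> flow3 h S.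
Proof.
move=> FC X1; apply: (merge_rooted FC (eps := fun=> 1)) => //; first by left.
  move=> e x y xX yX xy _; have := cardsD1 x X; have := cardsD1 y (X :\ x).
  by rewrite xX !inE yX eq_sym xy; move: X1; clear; lia.
have := deg_cubic_set FC; move: X1; rewrite /dist6; clear; lia.
Qed.

(** An edge inside [X] lowers the degree of the merged root from 6 or 9 to at most 4
    or 7.  A consistent choice of sources and sinks exists because the cubic vertices
    cannot form a triangle: its complement would have three boundary edges or be
    empty, the latter against parity. *)
Lemma few_cubic_adjacent h S X z e x1 x2 : few_cubic h S X z ->
  x1 \in X -> x2 \in X -> x1 != x2 -> joins (h e) x1 x2 -> flow3 h S.
Proof.
move=> FC x1X x2X x12 j12; have [wf zS XS X3 dX cut br] := FC.
have cX := deg_cubic_set FC; have c1 := cardsD1 x1 X; have c2 := cardsD1 x2 (X :\ x1).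
have x21 : x2 != x1 by rewrite eq_sym.
rewrite x1X in c1; rewrite !inE x21 x2X /= in c2.
(* A third cubic vertex is a sink if it is joined to the source x1, and a source
   otherwise. *)
pose eps v : int := if v == x2 then -1 else if v == x1 then 1 else
  if [exists f, joins (h f) x1 v] then -1 else 1.
have third a b : a \in X -> b \in X -> a != x1 -> a != x2 -> b != x1 -> b != x2 -> a = b.
  move=> aX bX a1 a2 b1 b2; apply/eqP/negPn/negP=> ab.
  have := cardsD1 a (X :\ x1 :\ x2); have := cardsD1 b (X :\ x1 :\ x2 :\ a).
  rewrite !inE a1 a2 b1 b2 aX bX eq_sym ab /=.
  by move: X3 c1 c2; clear; lia.
have no_triangle b f f' : b \in X -> b != x1 -> b != x2 -> joins (h f) x1 b ->
    joins (h f') x2 b -> False.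
  move=> bX b1 b2 j j'.
  have n1 : e != f.
    apply/eqP=> ef; have := joins_crossing [set b] j12; rewrite ef (joins_crossing _ j) !inE.
    by rewrite eqxx ![_ == b]eq_sym (negPf b1) (negPf b2).
  have n2 : e != f'.
    apply/eqP=> ef; have := joins_crossing [set b] j12; rewrite ef (joins_crossing _ j') !inE.
    by rewrite eqxx ![_ == b]eq_sym (negPf b1) (negPf b2).
  have n3 : f != f'.
    apply/eqP=> ef; have := joins_crossing [set x1] j; rewrite ef (joins_crossing _ j') !inE.
    by rewrite eqxx (negPf b1) (negPf x21).
  have cX3 : #|X| = 3%N.
    have := cardsD1 b (X :\ x1 :\ x2); rewrite !inE b1 b2 bX /=.
    by move: X3 c1 c2; clear; lia.
  have xb1 : x1 != b by rewrite eq_sym.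
  have xb2 : x2 != b by rewrite eq_sym.
  have sub : [set e; f; f'] \subset inner h X.
    apply/subsetP=> k; rewrite !inE -orbA => /or3P[] /eqP ->.
    - by have := inner_joins x1X x2X x12 j12; rewrite inE.
    - by have := inner_joins x1X bX xb1 j; rewrite inE.
    - by have := inner_joins x2X bX xb2 j'; rewrite inE.
  have c3 : #|[set e; f; f']| = 3%N.
    by rewrite setUC cardsU1 !inE cards2 n1 eq_sym (negPf n2) eq_sym (negPf n3).
  have := subset_leq_card sub; rewrite c3 => i3.
  have dS : deg h S = 0%N.
    by rewrite -(degD wf (subxx S)) setDv /deg big1 // => k _; rewrite /crossing !inE.
  have SX : S :\: X != set0.
    apply/eqP=> D0; have SE : S = X by apply/eqP; rewrite eqEsubset XS andbT -setD_eq0 D0.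
    by move: cX; rewrite -SE dS SE; move: cX3; clear; lia.
  have dis : [disjoint S :\: X & X] by apply: disjointI => u; rewrite inE => /andP[/negPf ->].
  have := cut _ (subsetDl S X) SX _ dis; rewrite (degD wf XS).
  suff [H1 H2] : S :\: X != S /\ forall x, x \in X -> S :\: X != S :\ x.
    by move=> /(_ H1 H2); move: cX X3 i3; clear; lia.
  split.
    by apply/eqP=> H; have := subsetP XS x1 x1X; rewrite -H inE x1X.
  move=> x xX; have [y yX yx] : exists2 y, y \in X & y != x.
    by case: (x1 =P x) => [<-|/eqP]; [exists x2 | exists x1].
  apply/eqP=> H; have : y \in S :\ x by rewrite !inE yx (subsetP XS).
  by rewrite -H inE yX.
have opp : opposite h X eps.
  move=> f a b aX bX ab j; have ba : b != a by rewrite eq_sym.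
  have key c d : c \in X -> d \in X -> c != d -> joins (h f) c d -> d != x1 -> d != x2 ->
      eps c = - eps d.
    move=> cX' dX' cd jcd d1 d2; rewrite /eps (negPf d1) (negPf d2).
    case: (c =P x2) => [cE|/eqP c2'].
      case: ifP => // /existsP[f1 j1]; rewrite cE in jcd.
      by case: (no_triangle d f1 f dX' d1 d2 j1 jcd).
    case: (c =P x1) => [cE|/eqP c1'].
      have -> // : [exists f0, joins (h f0) x1 d] by apply/existsP; exists f; rewrite -cE.
    by move: cd; rewrite (third c d) ?eqxx.
  case: (boolP ((b == x1) || (b == x2))) => [bb|]; last first.
    by rewrite negb_or => /andP[b1 b2]; apply: (key a b).
  case: (boolP ((a == x1) || (a == x2))) => [aa|]; last first.
    rewrite negb_or => /andP[a1 a2]; rewrite joinsC in j.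
    by rewrite (key b a) ?opprK.
  move: aa bb ab; rewrite /eps.
  by do 2![case/orP=> /eqP ->]; rewrite ?eqxx ?(negPf x12) ?(negPf x21) ?eqxx.
have eps_sign v : eps v = 1 \/ eps v = -1.
  rewrite /eps; case: ifP => _; first by right.
  case: ifP => _; first by left.
  by case: ifP => _; [right | left].
apply: (merge_rooted FC eps_sign opp).
have i1 : (0 < #|inner h X|)%N by apply/card_gt0P; exists e; exact: inner_joins j12.
by move: cX X3 i1 c1 c2; rewrite /dist6; clear; lia.
Qed.

End FewCubicFlow.

(** * Independent cubic vertices *)

Section FewCubicMain.

Variables E V : finType.
Implicit Types (h : E -> V * V) (A B S X : {set V}) (p : V * V).
Implicit Types (g : E -> int) (T eps : V -> int).

Definition independent h X := forall e x y, x \in X -> y \in X -> x != y ->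
  ~~ joins (h e) x y.

Definition no_cut3 h S := forall A, A \subset S -> (1 < #|A|)%N ->
  (1 < #|S :\: A|)%N -> deg h A <> 3%N.

Definition fc_slack_all h S X := forall A, A \subset S -> (1 < #|A|)%N -> A != S ->
  [disjoint A & X] -> (6 + dist6 (3 * (deg h A)%:Z) <= deg h A)%N.

Lemma independent_inner h X : independent h X -> inner h X = set0.
Proof.
move=> ind; apply/setP=> e; rewrite !inE; apply/negP=> /and3P[e1 e2 ne].
by have := ind e _ _ e1 e2 ne; rewrite /joins -surjective_pairing eqxx.
Qed.

(** Splitting [v] into two pairs lowers the boundary of [A] only if one pair has both
    ends in [A], and then by 2 if the other pair does not.  In that case [A] and
    [v |: A] had boundaries of equal size, or [A] now has the boundary size that
    [v |: A] had.  So sets avoiding [X] live on the slack of [A] and [v |: A], and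
    a bridge could only come from two 3-edge-cuts, which are both trivial. *)
Lemma few_cubic_split h S X z v : few_cubic h S X z -> smaller_cubic E #|S| z ->
  (1 < #|X|)%N -> independent h X -> no_cut3 h S -> fc_slack_all h S X ->
  v \in S :\: X -> deg h [set v] = 4%N -> flow3 h S.
Proof.
move=> FC IH X2 ind nc3 SL; rewrite inE => /andP[vX vS] d4.
have [wf zS XS X3 dX cut br] := FC.
have pair6 x u : x \in X -> u \in X -> x != u -> deg h [set x; u] = 6%N.
  move=> xX uX xu; have := deg_sum h [set x; u].
  have sub : [set x; u] \subset X by apply/subsetP=> a; rewrite !inE => /orP[] /eqP ->.
  rewrite big_setU1 ?inE //= big_set1 !dX //.
  have -> : [set e | [&& (h e).1 \in [set x; u], (h e).2 \in [set x; u] & (h e).1 != (h e).2]] = set0.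
    by apply: independent_inner => e a b /(subsetP sub) aX /(subsetP sub) bX; apply: ind.
  by rewrite cards0 addn0.
have [x0 x0X] : exists x, x \in X by apply/card_gt0P; apply: ltnW.
have x0v : x0 != v by apply: contraNneq vX => <-.
have x0S := subsetP XS x0 x0X.
pose F := [set e | crossing [set v] (h e)].
have cF : size (enum F) = 4%N by rewrite -cardE -degE.
have memF e : e \in enum F = crossing [set v] (h e) by rewrite mem_enum inE.
have uF := enum_uniq F.
case: (enum F) cF memF uF => [|e0 [|e1 [|e2 [|e3 [|]]]]] //= _ memF.
rewrite !inE !negb_or => /and4P[/and3P[n01 n02 n03] /andP[n12 n13] n23 _].
have ends e : e \in [:: e0; e1; e2; e3] -> exists2 w, w != v & joins (h e) w v.
  by rewrite memF => /crossing_end.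
have [w0 w0v j0] : exists2 w, w != v & joins (h e0) w v by apply: ends; rewrite !inE eqxx.
have [w1 w1v j1] : exists2 w, w != v & joins (h e1) w v by apply: ends; rewrite !inE eqxx !orbT.
have [w2 w2v j2] : exists2 w, w != v & joins (h e2) w v by apply: ends; rewrite !inE eqxx !orbT.
have [w3 w3v j3] : exists2 w, w != v & joins (h e3) w v by apply: ends; rewrite !inE eqxx !orbT.
have [n10 n20 n30] : [/\ e1 != e0, e2 != e0 & e3 != e0] by rewrite ![_ == e0]eq_sym.
have [n21 n31 n32] : [/\ e2 != e1, e3 != e1 & e3 != e2].
  by rewrite ![_ == e1]eq_sym [e3 == e2]eq_sym.
have [w0S _] := joins_in wf j0; have [w1S _] := joins_in wf j1.
have [w2S _] := joins_in wf j2; have [w3S _] := joins_in wf j3.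
(* The first edge of each pair becomes the new edge, the second one a loop. *)
pose h1 := upd (upd h e0 (w0, w1)) e1 (w1, w1).
pose h2 := upd (upd h1 e2 (w2, w3)) e3 (w3, w3).
have wf1 : within h1 S by do 2![apply: within_upd => //=].
have wf2 : within h2 S by do 2![apply: within_upd => //=].
have degB B : (deg h2 B + ((w0 \in B) != (v \in B)) + ((w1 \in B) != (v \in B)) +
    ((w2 \in B) != (v \in B)) + ((w3 \in B) != (v \in B)) =
    deg h B + ((w0 \in B) != (w1 \in B)) + ((w2 \in B) != (w3 \in B)))%N.
  have := deg_upd (upd h1 e2 (w2, w3)) e3 (w3, w3) B; have := deg_upd h1 e2 (w2, w3) B.
  have := deg_upd (upd h e0 (w0, w1)) e1 (w1, w1) B; have := deg_upd h e0 (w0, w1) B.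
  rewrite -/h1 -/h2 (upd_neq _ _ n32) /h1 !(upd_neq _ _ n31) !(upd_neq _ _ n30).
  rewrite !(upd_neq _ _ n21) !(upd_neq _ _ n20) !(upd_neq _ _ n10) -/h1.
  rewrite (joins_crossing _ j0) (joins_crossing _ j1) (joins_crossing _ j2) (joins_crossing _ j3).
  rewrite /crossing /= !eqxx.
  move: (deg h2 B) (deg h1 B) (deg h B) (deg (upd h e0 _) B) (deg (upd h1 e2 _) B).
  by clear; lia.
have iso : deg h2 [set v] = 0%N.
  have := degB [set v]; rewrite !inE eqxx (negPf w0v) (negPf w1v) (negPf w2v) (negPf w3v) d4.
  by move: (deg h2 _); clear; lia.
have degv A : v \notin A -> deg h2 (v |: A) = deg h2 A.
  move=> vA; apply: eq_bigr => e _; have : ~~ crossing [set v] (h2 e).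
    by move: iso; rewrite /deg (bigD1 e) //=; case: crossing.
  rewrite /crossing !inE negbK => /eqP.
  case: ((h2 e).1 =P v) => [-> /esym/eqP ->|_ /esym ->] //.
  by rewrite !eqxx.
apply: (flow3_lift wf zS n01 w0v w1v j0 j1); rewrite -/h1.
have E2 : h1 e2 = h e2 by rewrite /h1 !upd_neq.
have E3 : h1 e3 = h e3 by rewrite /h1 !upd_neq.
apply: (@flow3_lift _ _ h1 S z e2 e3 v w2 w3); rewrite ?E2 ?E3 // -/h2.
apply: (flow3_isolated wf2 vS x0S x0v iso).
(* Only loops are left at v; merging v into x0 takes them off v. *)
have vxS : [set v; x0] \subset S by apply/subsetP=> a; rewrite !inE => /orP[] /eqP ->.
have x0vx : x0 \in [set v; x0] by rewrite !inE eqxx orbT.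
have imS : collapse [set v; x0] x0 @: S = S :\ v.
  rewrite imset_collapse //; apply/setP=> a; rewrite !inE.
  case: (a =P x0) => [->|] /=; first by rewrite x0v x0S.
  by rewrite orbF.
pose h3 := relabel (collapse [set v; x0] x0) h2.
have deg3 A : A \subset S :\ v -> deg h3 A = deg h2 A.
  move=> sA; apply: deg_isolated => //.
  by apply/negP=> /(subsetP sA); rewrite !inE eqxx.
have facts A : A \subset S :\ v -> exists a0 a1 a2 a3 : bool,
    (deg h2 A + a0 + a1 + a2 + a3 = deg h A + (a0 != a1) + (a2 != a3))%N /\
    (deg h2 A + ~~ a0 + ~~ a1 + ~~ a2 + ~~ a3 =
       deg h (v |: A) + (a0 != a1) + (a2 != a3))%N.
  move=> sA; have vA : v \notin A by apply/negP=> /(subsetP sA); rewrite !inE eqxx.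
  exists (w0 \in A), (w1 \in A), (w2 \in A), (w3 \in A).
  have D1 := degB A; have D2 := degB (v |: A).
  rewrite !inE (negPf w0v) (negPf w1v) (negPf w2v) (negPf w3v) eqxx /= (degv _ vA) in D2.
  rewrite (negPf vA) in D1; split.
    by move: D1; do 4!case: (_ \in A).
  by move: D2; do 4!case: (_ \in A).
have cubic3 w : w \in S -> deg h [set w] = 3%N -> w \in X.
  move=> wS dw; apply/negPn/negP=> wX.
  have dis : [disjoint [set w] & X] by apply: disjointI => u; rewrite inE => /eqP ->; rewrite (negPf wX).
  have wn0 : [set w] != set0 by apply/set0Pn; exists w; rewrite inE.
  by have := fc_cut_disjoint FC X2 _ wn0 dis; rewrite sub1set wS dw => /(_ isT).
have deg0 : deg h set0 = 0%N by rewrite /deg big1 // => k _; rewrite /crossing !inE.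
have degS : deg h S = 0%N by rewrite -(degD wf (subxx S)) setDv.
(* A bridge requires that A and v |: A both have three boundary edges.  Both cuts
   being trivial, the vertices are v and two cubic vertices w and u; but then
   v would have degree 6 instead of 4. *)
have br2 A : A \subset S :\ v -> deg h2 A != 1%N.
  move=> sA; have vA : v \notin A by apply/negP=> /(subsetP sA); rewrite !inE eqxx.
  have AS : A \subset S := subset_trans sA (subsetDl _ _).
  have vAS : v |: A \subset S by rewrite subUset sub1set vS.
  have [a0 [a1 [a2 [a3 [D1 D2]]]]] := facts A sA.
  apply/eqP=> d1; have [dA dvA] : deg h A = 3%N /\ deg h (v |: A) = 3%N.
    have := br A AS; have := br _ vAS; move: D1 D2; rewrite d1.
    move: (deg h A) (deg h (v |: A)); clear.
    by case: a0; case: a1; case: a2; case: a3 => /=; lia.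
  have vD : v \in S :\: A by rewrite inE vA vS.
  have A0 : A != set0 by apply/eqP=> A0; rewrite A0 deg0 in dA.
  case: (set1_or_large A0) => [[w Aw]|A1]; last first.
    have D1' : (#|S :\: A| <= 1)%N by rewrite leqNgt; apply/negP=> /(nc3 A AS A1).
    have DE : S :\: A = [set v].
      by apply/esym/eqP; rewrite eqEcard sub1set vD cards1.
    by have := degD wf AS; rewrite DE d4 dA.
  have wS : w \in S by rewrite -sub1set -Aw.
  have wX : w \in X by apply: cubic3; rewrite // -Aw.
  have vA2 : (1 < #|v |: A|)%N by rewrite cardsU1 vA Aw cards1.
  have Dv1 : (#|S :\: (v |: A)| <= 1)%N by rewrite leqNgt; apply/negP=> /(nc3 _ vAS vA2).
  have Dv0 : S :\: (v |: A) != set0.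
    by apply/eqP=> D0; have := degD wf vAS; rewrite D0 deg0 dvA.
  case: (set1_or_large Dv0) => [[u Du]|]; last by rewrite ltnNge Dv1.
  have : u \in S :\: (v |: A) by rewrite Du inE.
  rewrite Aw !inE negb_or => /andP[/andP[uv uw] uS].
  have uX : u \in X by apply: cubic3; rewrite // -Du (degD wf).
  have wu : w != u by rewrite eq_sym.
  have := pair6 w u wX uX wu; have <- : S :\ v = [set w; u].
    apply/setP=> a; rewrite !inE; move/setP: Du => /(_ a); rewrite Aw !inE.
    have wv : w != v by apply: contraNneq vA => <-; rewrite Aw inE.
    case: (a =P v) => [->|_] /=; first by rewrite ![v == _]eq_sym (negPf wv) (negPf uv).
    by case: (a =P w) => [->|_] //=; rewrite wS.
  by rewrite (degD wf) ?sub1set // d4.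
have XD x : x \in X -> x \in S :\ v.
  by move=> xX; rewrite !inE (subsetP XS) // andbT; apply: contraNneq vX => <-.
apply: (IH h3 (S :\ v) X); last first.
  by have := cardsD1 v S; rewrite vS; clear; lia.
split => //.
- by rewrite -imS; apply: within_relabel.
- by rewrite !inE (negPf zS) andbF.
- by apply/subsetP.
- move=> x xX; have sx : [set x] \subset S :\ v by rewrite sub1set XD.
  rewrite deg3 //; have := br2 _ sx; have [a0 [a1 [a2 [a3 [D1 _]]]]] := facts _ sx.
  move: D1; rewrite dX //; move: (deg h2 _); clear.
  by case: a0; case: a1; case: a2; case: a3 => /=; lia.
- move=> A sA A0 AnS AX _; rewrite deg3 //.
  have vA : v \notin A by apply/negP=> /(subsetP sA); rewrite !inE eqxx.
  have AS : A \subset S := subset_trans sA (subsetDl _ _).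
  have vAS : v |: A \subset S by rewrite subUset sub1set vS.
  have AnS' : A != S by apply: contraNneq vA => ->.
  have vAnS : v |: A != S by apply: contra_neq AnS => <-; rewrite setU1K.
  have vAX : [disjoint v |: A & X].
    apply: disjointI => u; rewrite !inE => /orP[/eqP ->|]; first by rewrite (negPf vX).
    exact: disjoint_in AX.
  have vA1 : (1 < #|v |: A|)%N by move: A0; rewrite cardsU1 vA -card_gt0; clear; lia.
  have dvA := SL _ vAS vA1 vAnS vAX.
  have [a0 [a1 [a2 [a3 [D1 D2]]]]] := facts A sA.
  have dA := fc_cut_disjoint FC X2 AS A0 AX.
  case: (set1_or_large A0) => [[w Aw]|A1].
    move: D1 D2 dvA dA; move: (deg h2 _) (deg h A) (deg h (v |: A)).
    by clear; case: a0; case: a1; case: a2; case: a3 => /=; rewrite /dist6; lia.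
  have dA' := SL _ AS A1 AnS' AX.
  move: D1 D2 dvA dA'; move: (deg h2 _) (deg h A) (deg h (v |: A)).
  by clear; case: a0; case: a1; case: a2; case: a3 => /=; rewrite /dist6; lia.
- by move=> A sA; rewrite deg3 // br2.
Qed.

(** Some edges at [x1] and [x2] can be deleted, unless they all go to one vertex [y]
    of degree 7; then [y], [x1] and [x2] together have a single boundary edge. *)
Lemma few_cubic_independent h S X z : few_cubic h S X z ->
  (1 < #|X|)%N -> independent h X -> fc_slack_all h S X ->
  (forall v, v \in S :\: X -> deg h [set v] <> 4%N) -> flow3 h S.
Proof.
move=> FC X2 ind SL n4; have [wf zS XS X3 dX cut br] := FC.
have dXX : deg h X = (3 * #|X|)%N.
  by rewrite (deg_cubic_set FC) (independent_inner ind) cards0 addn0.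
have [x1 x1X] : exists x, x \in X by apply/card_gt0P; apply: ltnW.
have [x2 x2X x21] := card_gt1_other x1 X2.
have x12 : x1 != x2 by rewrite eq_sym.
have nbr e x : x \in X -> crossing [set x] (h e) -> exists2 y, y \in S :\: X & joins (h e) x y.
  move=> xX /crossing_end[y yx j]; have [yS _] := joins_in wf j; exists y; last by rewrite joinsC.
  rewrite inE yS andbT; apply/negP=> yX.
  by have := ind e y x yX xX yx; rewrite j.
have edge x : x \in X -> exists e, crossing [set x] (h e).
  move=> xX; have : deg h [set x] != 0%N by rewrite dX.
  rewrite degE cards_eq0 => /set0Pn[e]; by rewrite inE => ce; exists e.
pose eps v : int := if v == x2 then -1 else 1.
have eps_sign v : eps v = 1 \/ eps v = -1 by rewrite /eps; case: ifP; [right|left].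
have opp : opposite h X eps.
  by move=> e a b aX bX ab j; have := ind e a b aX bX ab; rewrite j.
have eps1 : eps x1 = 1 by rewrite /eps (negPf x12).
have eps2 : eps x2 = -1 by rewrite /eps eqxx.
have d69 : deg h X = 6%N \/ deg h X = 9%N by rewrite dXX; move: X2 X3; clear; lia.
have SL' A : A \subset S :\: X -> (1 < #|A|)%N -> A != S :\: X ->
    (6 + dist6 (3 * (deg h A)%:Z) <= deg h A)%N.
  move=> sA A1 _; have dis : [disjoint A & X].
    by apply: disjointI => u /(subsetP sA); rewrite inE => /andP[/negPf ->].
  apply: SL => //; first exact: subset_trans sA (subsetDl _ _).
  apply: contraTneq x1X => AE; have := subsetP XS x1; rewrite -AE => x1A.
  by apply/negP=> x1X; exact: disjoint_in dis (x1A x1X) x1X.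
have n4' y : y \in S :\: X -> deg h [set y] != 4%N by move=> /n4 /eqP.
have [e1 c1] := edge x1 x1X; have [e2 c2] := edge x2 x2X.
have [y yD j1] := nbr _ _ x1X c1.
case: (boolP [exists f1, exists f2, exists y1, exists y2, [&& y1 \in S :\: X, y2 \in S :\: X,
    joins (h f1) x1 y1, joins (h f2) x2 y2 & y1 != y2]]).
  case/existsP=> f1 /existsP[f2 /existsP[y1 /existsP[y2 /and5P[y1D y2D jf1 jf2 y12]]]].
  apply: (merge_deleted FC eps_sign opp x1X x2X y1D y2D jf1 jf2 eps1 eps2 d69 SL').
  by left; split; rewrite // !n4'.
move=> H; have same f1 f2 y1 y2 : y1 \in S :\: X -> y2 \in S :\: X ->
    joins (h f1) x1 y1 -> joins (h f2) x2 y2 -> y1 = y2.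
  move=> y1D y2D jf1 jf2; apply/eqP; apply: contraNT H => y12.
  apply/existsP; exists f1; apply/existsP; exists f2; apply/existsP; exists y1.
  by apply/existsP; exists y2; rewrite y1D y2D jf1 jf2 y12.
have [y' y'D j2] := nbr _ _ x2X c2.
have yy' := same _ _ _ _ yD y'D j1 j2.
case: (deg h [set y] =P 7%N) => [d7|/eqP d7]; last first.
  apply: (merge_deleted FC eps_sign opp x1X x2X yD y'D j1 j2 eps1 eps2 d69 SL').
  by right; rewrite n4'.
exfalso; have := yD; rewrite inE => /andP[yX yS].
have yx1 : y != x1 by apply: contraNneq yX => ->.
have yx2 : y != x2 by apply: contraNneq yX => ->.
pose B := [set y; x1; x2].
have BS : B \subset S.
  by apply/subsetP=> u; rewrite !inE -orbA => /or3P[] /eqP -> //; apply: (subsetP XS).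
have dB : (13 = deg h B + #|inner h B|.*2)%N.
  rewrite -deg_sum /B [_ :|: [set x2]]setUC big_setU1; last first.
    by rewrite !inE negb_or ![x2 == _]eq_sym yx2 x12.
  by rewrite big_setU1 ?inE //= big_set1 (dX x1 x1X) (dX x2 x2X) d7.
pose F x := [set e | crossing [set x] (h e)].
have sub : F x1 :|: F x2 \subset inner h B.
  apply/subsetP=> e; rewrite inE => /orP[]; rewrite inE => ce.
    have [w wD jw] := nbr _ _ x1X ce; have wE := same _ _ _ _ wD y'D jw j2; rewrite wE -yy' in jw.
    by apply: (inner_joins _ _ _ jw); rewrite ?inE ?eqxx ?orbT 1?eq_sym.
  have [w wD jw] := nbr _ _ x2X ce; have wE := same _ _ _ _ yD wD j1 jw; rewrite -wE in jw.
  by apply: (inner_joins _ _ _ jw); rewrite ?inE ?eqxx ?orbT 1?eq_sym.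
have F12 : F x1 :&: F x2 = set0.
  apply/setP=> e; rewrite !inE; apply/negP=> /andP[ce1 ce2].
  have [w] := nbr _ _ x1X ce1; rewrite inE => /andP[wX wS] jw.
  move: ce2; rewrite (joins_crossing _ jw) !inE (negPf x12) /= => /negPn/eqP wx2.
  by rewrite wx2 x2X in wX.
have c6 : #|F x1 :|: F x2| = 6%N by rewrite cardsU F12 cards0 /F -!degE !dX.
have := subset_leq_card sub; rewrite c6; have := br B BS; move: dB.
by move: (deg h B); clear; lia.
Qed.

Theorem few_cubic_flow3 h S X z : few_cubic h S X z -> flow3 h S.
Proof.
have [n] := ubnP #|S|; elim: n h S X => // n IHn h S X lt_n FC.
have IH : smaller_cubic E #|S| z.
  by move=> h' S' X' FC' lt; apply: IHn FC'; move: lt_n lt; clear; lia.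
case: (leqP #|X| 1) => X2; first exact: few_cubic_small FC X2.
case: (boolP [exists e, exists x, exists y, [&& x \in X, y \in X, x != y & joins (h e) x y]]).
  case/existsP=> e /existsP[x /existsP[y /and4P[xX yX xy j]]].
  exact: few_cubic_adjacent FC xX yX xy j.
move=> H; have ind : independent h X.
  move=> e x y xX yX xy; apply: contra H => j.
  by apply/existsP; exists e; apply/existsP; exists x; apply/existsP; exists y; rewrite xX yX xy.
case: (boolP [exists A : {set V}, [&& A \subset S, (1 < #|A|)%N, A != S, [disjoint A & X] &
    (deg h A < 6 + dist6 (3 * (deg h A)%:Z))%N]]).
  case/existsP=> A /and5P[AS A1 AnS AX dA].
  by case: (fc_slack FC IH X2 AS A1 AnS AX) => //; rewrite leqNgt dA.
rewrite negb_exists => /forallP SL0.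
have SL : fc_slack_all h S X.
  by move=> A AS A1 AnS AX; have := SL0 A; rewrite AS A1 AnS AX /= -leqNgt.
case: (boolP [exists A : {set V}, [&& A \subset S, (1 < #|A|)%N, (1 < #|S :\: A|)%N &
    deg h A == 3%N]]).
  by case/existsP=> A /and4P[AS A1 D1 /eqP d3]; exact: fc_cut3 FC IH AS A1 D1 d3.
rewrite negb_exists => /forallP NC.
have nc3 : no_cut3 h S.
  by move=> A AS A1 D1 /eqP d3; have := NC A; rewrite AS A1 D1 d3.
case: (boolP [exists v, (v \in S :\: X) && (deg h [set v] == 4%N)]).
  by case/existsP=> v /andP[vD /eqP d4]; exact: few_cubic_split FC IH X2 ind nc3 SL vD d4.
rewrite negb_exists => /forallP N4.
apply: few_cubic_independent FC X2 ind SL _ => v vD /eqP d4.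
by have := N4 v; rewrite vD d4.
Qed.

End FewCubicMain.

(** * Removing the cuts of size zero, two and three *)

Section Thin.

Variables E V : finType.
Implicit Types (h : E -> V * V) (A B S X : {set V}) (p : V * V).
Implicit Types (g : E -> int).

Definition edge_cut h A : {set E} := [set e | crossing A (h e)].
Definition cuts3 h S : {set {set E}} :=
  [set C in [set edge_cut h A | A in powerset S] | #|C| == 3%N].

(** Cuts are counted as edge sets, so that contraction does not increase their
    number. *)
Record thin h S z : Prop := Thin {
  thin_within : within h S;
  thin_fresh : z \notin S;
  thin_bridge : forall A, A \subset S -> deg h A != 1%N;
  thin_cut5 : forall A, A \subset S -> deg h A != 5%N;
  thin_cuts3 : (#|cuts3 h S| <= 3)%N }.

Lemma thin_contract h S z A r : thin h S z -> A \subset S -> r \in A ->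
  thin (relabel (collapse A r) h) (collapse A r @: S) z.
Proof.
move=> [wf zS b1 b5 c3] AS rA; split.
- exact: within_relabel.
- exact: fresh_collapse.
- by move=> B _; rewrite (deg_relabel _ _ wf); apply: b1; apply: pre_sub.
- by move=> B _; rewrite (deg_relabel _ _ wf); apply: b5; apply: pre_sub.
apply: leq_trans c3; apply: subset_leq_card; apply/subsetP=> C.
rewrite !inE => /andP[/imsetP[B _ ->] ->]; rewrite andbT.
apply/imsetP; exists (pre (collapse A r) S B); first by rewrite inE pre_sub.
by apply/setP=> e; rewrite !inE (crossing_relabel _ _ _ wf).
Qed.

(** The net outflow of [u] is fixed by that of [A] and of the other vertices of [A];
    that of [w] is then fixed by that of the pair. *)
Lemma flow3_identify h S A u w g1 g : within h S -> A \subset S -> u \in A ->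
  w \in S :\: A -> sign g ->
  {in collapse [set u; w] u @: S, forall v, (3 %| net (relabel (collapse [set u; w] u) h) g1 [set v])%Z} ->
  (forall e, g e != g1 e -> joins (h e) u w) -> net h g A = 0 -> flow3 h S.
Proof.
move=> wf AS uA; rewrite inE => /andP[wA wS] sg n1 off nA; exists g => //.
have uS := subsetP AS u uA; have uw : u != w by apply: contraNneq wA => <-.
have BS : [set u; w] \subset S by apply/subsetP=> a; rewrite !inE => /orP[] /eqP ->.
have uB : u \in [set u; w] by rewrite !inE eqxx.
have same B : (u \in B) = (w \in B) -> net h g B = net h g1 B.
  move=> uwB; apply: eq_bigr => e _; case: (g e =P g1 e) => [-> //|/eqP ge].
  by rewrite (joins_incid _ uw (off e ge)) uwB subrr !mulr0.
have rest v : v \in S -> v != u -> v != w -> (3 %| net h g [set v])%Z.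
  move=> vS vu vw; rewrite same ?inE 1?eq_sym ?(negPf vu) 1?eq_sym ?(negPf vw) //.
  have vI : v \in collapse [set u; w] u @: S by rewrite imset_collapse // !inE negb_or vu vw vS orbT.
  by have := n1 v vI; rewrite (net_relabel _ _ _ wf) pre_collapse1 // !inE negb_or vu vw.
have nu : (3 %| net h g [set u])%Z.
  have := nA; rewrite net_sum (big_setD1 u) //=.
  have : (3 %| \sum_(v in A :\ u) net h g [set v])%Z.
    apply: (big_ind (fun x => 3 %| x)%Z) => // [a b|v]; first by clear; lia.
    rewrite !inE => /andP[vu vA]; apply: rest => //; first exact: (subsetP AS).
    by apply: contraNneq wA => <-.
  by move: (\sum_(v in _) _) (net _ _ _); clear; lia.
move=> v vS; case: (v =P u) => [-> //|/eqP vu]; case: (v =P w) => [->|/eqP vw]; last exact: rest.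
have uI : u \in collapse [set u; w] u @: S by rewrite imset_collapse // setU11.
have := n1 u uI; rewrite (net_relabel _ _ _ wf) pre_collapse // -same ?inE ?eqxx ?orbT //.
by rewrite net_pair //; move: nu; clear; lia.
Qed.

(** Without cuts of size at most 2, 5 and nontrivial cuts of size 3, distinct cubic
    vertices have distinct boundaries, so there are at most three of them. *)
Theorem thin_flow3 h S z : thin h S z -> flow3 h S.
Proof.
have [n] := ubnP #|S|; elim: n h S => // n IHn h S lt_n TH.
have IH A r : A \subset S -> r \in A -> (1 < #|A|)%N ->
    flow3 (relabel (collapse A r) h) (collapse A r @: S).
  move=> AS rA A1; apply: IHn (thin_contract TH AS rA).
  by have := card_collapse AS rA A1; move: lt_n; clear; lia.
have [wf zS b1 b5 c3] := TH.
case: (boolP [exists A : {set V}, [&& A \subset S, A != set0, A != S & (deg h A <= 2)%N]]).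
  case/existsP=> A /and4P[AS A0 AnS d2].
  have dA : deg h A = 0%N \/ deg h A = 2%N.
    by have := b1 A AS; move: d2; clear; lia.
  have pick u w : u \in A -> w \in S :\: A -> exists2 g1, sign g1 &
      {in collapse [set u; w] u @: S, forall v, (3 %| net (relabel (collapse [set u; w] u) h) g1 [set v])%Z}.
    rewrite inE => uA /andP[wA wS]; have uS := subsetP AS u uA.
    apply: IH.
    - by apply/subsetP=> a; rewrite !inE => /orP[] /eqP ->.
    - by rewrite !inE eqxx.
    - by rewrite cards2; have -> : u != w by apply: contraNneq wA => <-.
  case: dA => dA.
    have /set0Pn[u uA] := A0.
    have /set0Pn[w wD] : S :\: A != set0.
      by apply: contra_neq AnS => D0; apply/eqP; rewrite eqEsubset AS -setD_eq0 D0 eqxx.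
    have [g1 sg1 n1] := pick u w uA wD.
    apply: (flow3_identify wf AS uA wD sg1 n1) => [e|]; first by rewrite eqxx.
    rewrite /net big1 // => e _; have : ~~ crossing A (h e).
      by move: dA; rewrite /deg (bigD1 e) //=; case: crossing.
    by rewrite /crossing /incid negbK => /eqP ->; rewrite subrr mulr0.
  move: (dA); rewrite degE => /eqP/cards2P[e [e' [ee' cE]]].
  have ce : crossing A (h e) by move/setP/(_ e): cE; rewrite !inE eqxx.
  have ce' : crossing A (h e') by move/setP/(_ e'): cE; rewrite !inE eqxx orbT.
  have inc f : crossing A (h f) -> incid A (h f) = 1 \/ incid A (h f) = -1.
    by rewrite /crossing /incid; case: (_ \in A); case: (_ \in A) => //= _; [left|right].
  have [u [w [uA wD j]]] : exists u w, [/\ u \in A, w \in S :\: A & joins (h e) u w].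
    have [s1 s2] := wf e; move: ce; rewrite /crossing /joins.
    case: (boolP ((h e).1 \in A)) => h1; case: (boolP ((h e).2 \in A)) => h2 // _.
      by exists (h e).1, (h e).2; rewrite inE h1 h2 s2 -surjective_pairing eqxx.
    by exists (h e).2, (h e).1; rewrite inE h1 h2 s1 -surjective_pairing eqxx orbT.
  have [g1 sg1 n1] := pick u w uA wD.
  (* This sign cancels the outflow of A through the other edge of the cut. *)
  pose c := - (g1 e' * incid A (h e') * incid A (h e)).
  have sg : sign (upd g1 e c).
    move=> f; rewrite /upd; case: eqP => // _; rewrite /c.
    by case: (inc e ce) => ->; case: (inc e' ce') => ->; case: (sg1 e') => ->;
      (try by left); right.
  apply: (flow3_identify wf AS uA wD sg n1) => [f|].
    by rewrite /upd; case: (f =P e) => [-> //|_]; rewrite eqxx.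
  rewrite /net (bigD1 e) //= (bigD1 e') 1?eq_sym //= big1 ?addr0.
    rewrite upd_eq upd_neq 1?eq_sym // /c.
    by case: (inc e ce) => ->; case: (inc e' ce') => ->; clear; lia.
  move=> f /andP[fe fe']; move/setP/(_ f): cE; rewrite !inE (negPf fe) (negPf fe') /=.
  by rewrite /crossing /incid => /negbFE/eqP ->; rewrite subrr mulr0.
rewrite negb_exists => /forallP SM.
have big A : A \subset S -> A != set0 -> A != S -> (3 <= deg h A)%N.
  by move=> AS A0 AnS; have := SM A; rewrite AS A0 AnS /= -ltnNge.
case: (boolP [exists A : {set V}, [&& A \subset S, (1 < #|A|)%N, (1 < #|S :\: A|)%N &
    deg h A == 3%N]]).
  case/existsP=> A /and4P[AS A1 D1 /eqP d3].
  have [r rA] : exists r, r \in A by apply/card_gt0P; apply: ltnW.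
  have [q qD] : exists q, q \in S :\: A by apply/card_gt0P; apply: ltnW.
  by apply: (flow3_cut3 wf zS AS rA qD d3); apply: IH => //; apply: subsetDl.
rewrite negb_exists => /forallP NC.
pose X := [set v in S | deg h [set v] == 3%N].
apply: (@few_cubic_flow3 _ _ h S X z); split => //.
- by apply/subsetP=> v; rewrite inE => /andP[].
- rewrite leqNgt; apply/negP=> X4.
  have inj : {in X &, injective (fun v => edge_cut h [set v])}.
    move=> u v; rewrite !inE => /andP[uS _] /andP[vS _] uv; apply/eqP/negPn/negP=> nuv.
    have uvS : [set u; v] \subset S by apply/subsetP=> a; rewrite !inE => /orP[] /eqP ->.
    have := big [set u; v] uvS; rewrite -card_gt0 cards2 nuv => /(_ isT).
    have -> : [set u; v] != S.
      apply: contraTneq X4 => uvE; rewrite -leqNgt.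
      have : (#|X| <= #|S|)%N by apply: subset_leq_card; apply/subsetP=> a; rewrite inE => /andP[].
      by rewrite -uvE cards2 nuv; clear; lia.
    rewrite /deg big1 => [/(_ isT)//|e _].
    have nboth a : ~~ ((a == u) && (a == v)).
      by apply/negP=> /andP[/eqP -> /eqP uv']; rewrite uv' eqxx in nuv.
    move/setP: uv => /(_ e); rewrite !inE /crossing !inE.
    move: (nboth (h e).1) (nboth (h e).2).
    by case: (_.1 == u); case: (_.1 == v); case: (_.2 == u); case: (_.2 == v).
  have := card_in_imset inj; move: X4; rewrite ltnNge => /negP X4 cI; apply: X4.
  rewrite -cI; apply: leq_trans c3; apply: subset_leq_card; apply/subsetP=> C.
  case/imsetP=> v; rewrite inE => /andP[vS /eqP dv] ->.
  by rewrite inE -degE dv eqxx andbT imset_f // inE sub1set.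
- by move=> x; rewrite inE => /andP[_ /eqP].
move=> A AS A0 AnS AX AnX; have d3 := big A AS A0 AnS; have d5 := b5 A AS.
suff : deg h A != 3%N by move: d3 d5; rewrite /dist6; clear; lia.
apply/eqP=> dA; case: (set1_or_large A0) => [[v Av]|A1].
  apply: (disjoint_in AX (u := v)); first by rewrite Av inE.
  by rewrite inE -sub1set -Av AS dA.
have D0 : S :\: A != set0.
  by apply: contra_neq AnS => D0; apply/eqP; rewrite eqEsubset AS -setD_eq0 D0 eqxx.
case: (set1_or_large D0) => [[x Dx]|D1]; last first.
  by have := NC A; rewrite AS A1 D1 dA.
have xD : x \in S :\: A by rewrite Dx inE.
have xX : x \in X by rewrite inE -Dx (degD wf) // dA; move: xD; rewrite inE => /andP[_ ->].
by have /eqP := AnX x xX; apply; rewrite -Dx setDDr setDv set0U (setIidPr AS).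
Qed.

End Thin.

(** * From modulo 3 to the integers *)

Section Integral.

Variables E V : finType.
Implicit Types (h : E -> V * V) (A : {set V}) (f g : E -> int).

Definition flow3_values f : Prop := forall e, f e \in [:: 1; -1; 2; -2].

Definition imbalance h f : nat := \sum_v absz (net h f [set v]).

(** The edge carries 1 or 2 from [x] to [y]; lowering this by 3 gives -2 or -1. *)
Definition residual h f : rel V := fun x y =>
  (x != y) && [exists e, joins (h e) x y && (0 < f e * leaving (h e) x)].

(** The path being simple, the residual edges after the first one are not affected
    by the change at [x]. *)
Lemma push_path h f x p : flow3_values f -> path (residual h f) x p -> uniq (x :: p) ->
  exists2 f', flow3_values f' & forall v,
    net h f' [set v] = net h f [set v] - 3 * (x == v)%:Z + 3 * (last x p == v)%:Z.
Proof.
elim: p f x => [|y p IH] f x sf /=.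
  by exists f => // v; clear; lia.
case/andP=> /andP[xy /existsP[e /andP[j fe]]] pp /andP[xyp up].
pose f1 := upd f e (f e - 3 * leaving (h e) x).
have sf1 : flow3_values f1.
  move=> d; rewrite /f1 /upd; case: eqP => // _; have := sf e; rewrite !inE => /or4P fE.
  by move: fe; case: (leaving_sign (h e) x) => ->; case: fE => /eqP ->.
have pp1 : path (residual h f1) y p.
  apply: (@sub_in_path _ [pred v | v != x]) pp; last first.
    by apply/allP=> v vp; rewrite inE; apply: contraNneq xyp => <-.
  move=> a b; rewrite !inE => ax bx /andP[ab /existsP[d /andP[jd fd]]]; apply/andP; split=> //.
  apply/existsP; exists d; rewrite jd /f1 upd_neq //; apply/eqP=> de.
  have := joins_crossing [set x] jd; rewrite de (joins_crossing _ j) !inE eqxx eq_sym.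
  by rewrite [y == x]eq_sym (negPf xy) (negPf ax) (negPf bx).
have [f' sf' nf'] := IH f1 y sf1 pp1 up; exists f' => // v.
rewrite nf' net_updg (joins_incid _ xy j) !inE.
by case: (leaving_sign (h e) x) => ->; move: (net _ _ _); clear; lia.
Qed.

(** The edges leaving the set reachable from [v] carry negative values outwards, so
    its net outflow cannot be positive. *)
Lemma reach_deficit h f v : flow3_values f -> (0 < net h f [set v]) ->
  exists2 w, connect (residual h f) v w & net h f [set w] < 0.
Proof.
move=> sf vpos; pose W := [set w | connect (residual h f) v w].
case: (boolP [exists w, (w \in W) && (net h f [set w] < 0)]).
  by case/existsP=> w /andP[]; rewrite inE; exists w.
rewrite negb_exists => /forallP H; exfalso.
have Wpos w : w \in W -> 0 <= net h f [set w].
  by move=> wW; have := H w; rewrite wW /= -leNgt.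
have vW : v \in W by rewrite inE connect0.
have : 0 < net h f W.
  rewrite net_sum (big_setD1 v) //= ltr_pwDl // sumr_ge0 // => w.
  by rewrite inE => /andP[_]; exact: Wpos.
rewrite ltNge /net => /negP; apply; apply: sumr_le0 => e _.
have out x y : joins (h e) x y -> x \in W -> y \notin W -> f e * incid W (h e) <= 0.
  move=> j xW yW; have xy : x != y by apply: contraNneq yW => <-.
  rewrite (joins_incid _ xy j) xW (negPf yW) subr0 mulr1 leNgt.
  apply: contra yW => fpos; move: xW; rewrite !inE => vx; apply: connect_trans vx (connect1 _).
  by rewrite /residual xy; apply/existsP; exists e; rewrite j.
case: (boolP ((h e).1 \in W)) => h1; case: (boolP ((h e).2 \in W)) => h2.
- by rewrite /incid h1 h2 subrr mulr0.
- by apply: (out _ _ _ h1 h2); rewrite /joins -surjective_pairing eqxx.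
- by apply: (out _ _ _ h2 h1); rewrite /joins -surjective_pairing eqxx orbT.
- by rewrite /incid (negPf h1) (negPf h2) subrr mulr0.
Qed.

Lemma net_setT h f : net h f setT = 0.
Proof. by rewrite /net big1 // => e _; rewrite /incid !inE subrr mulr0. Qed.

(** Induction on the total imbalance: a nonzero net outflow has absolute value at
    least 3, so each push lowers the total by 6. *)
Theorem integral_flow h : flow3 h setT ->
  exists2 f, flow3_values f & forall v, net h f [set v] = 0.
Proof.
case=> g sg g3.
have : exists2 f, flow3_values f & forall v, (3 %| net h f [set v])%Z.
  exists g => [e|v]; last exact: g3.
  by case: (sg e) => ->; rewrite !inE.
case=> f; have [n] := ubnP (imbalance h f); elim: n f => // n IH f lt_n sf f3.
case: (boolP [exists v, 0 < net h f [set v]]); last first.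
  rewrite negb_exists => /forallP H; exists f => // v.
  have le0 w : net h f [set w] <= 0 by rewrite leNgt H.
  have := net_setT h f; rewrite net_sum (bigD1 v) ?inE //= => /eqP.
  rewrite naddr_eq0 ?le0 ?sumr_le0 //; first by case/andP=> /eqP.
case/existsP=> v vpos; have [w vw wneg] := reach_deficit sf vpos.
case/connectP: vw => p pp wE; case/shortenP: pp wE => q pq uq _ wE.
have [f' sf' nf'] := push_path sf pq uq.
have vw : v != w by apply: contraTneq vpos => ->; rewrite -leNgt ltW.
apply: (IH f') => // [|u]; last first.
  by have := f3 u; rewrite nf'; move: (net _ _ _); clear; lia.
move: lt_n; rewrite /imbalance (bigD1 v) //= (bigD1 w) 1?eq_sym //=.
rewrite [X in _ -> (X < _)%N](bigD1 v) //= [X in _ -> (_ + X < _)%N](bigD1 w) 1?eq_sym //=.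
rewrite (eq_bigr (fun u => absz (net h f' [set u]))) => [|u /andP[uv uw]]; last first.
  by rewrite nf' -wE ![_ == u]eq_sym (negPf uv) (negPf uw) mulr0 subr0 addr0.
move: vpos wneg (f3 v) (f3 w); rewrite !nf' -wE !eqxx [w == v]eq_sym (negPf vw).
move: (net h f [set v]) (net h f [set w]) (\sum_(_ | _) _)%N; clear; lia.
Qed.

End Integral.


(** * Multigraphs as families of directed edges *)

Section Orient.

Variable G : mgraph.
Variable D : edge G -> vertex G * vertex G.
Hypothesis D_ends : orientation D.

Lemma tail_head e : (D e).1 != (D e).2.
Proof. by have := card_ends e; rewrite D_ends cards2; case: eqP. Qed.

Lemma ends_joins e u v : ends e = [set u; v] -> joins (D e) u v.
Proof.
rewrite D_ends => /setP uv; have := tail_head e; rewrite /joins.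
have := uv (D e).2; have := uv (D e).1; rewrite !inE !eqxx !orbT /= => /esym h1 /esym h2.
case: (D e) h1 h2 => a b /= /orP[] /eqP -> /orP[] /eqP ->; rewrite ?eqxx ?orbT //.
Qed.

Lemma mem_cut X e : (e \in cut X) = crossing X (D e).
Proof.
rewrite inE; apply/existsP/idP.
  case=> u /andP[uX /existsP[v /andP[]]]; rewrite inE => vX /eqP /ends_joins j.
  by rewrite (joins_crossing _ j) uX (negPf vX).
rewrite /crossing; case: (boolP ((D e).1 \in X)) => h1; case: (boolP ((D e).2 \in X)) => h2 // _.
  by exists (D e).1; rewrite h1; apply/existsP; exists (D e).2; rewrite inE h2 D_ends eqxx.
by exists (D e).2; rewrite h2; apply/existsP; exists (D e).1; rewrite inE h1 D_ends setUC eqxx.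
Qed.

Let h e := (Some (D e).1, Some (D e).2).
Let S : {set option (vertex G)} := ~: [set None].

Lemma crossing_some A e : crossing A (h e) = (e \in cut [set v | Some v \in A]).
Proof. by rewrite mem_cut /crossing !inE. Qed.

Lemma deg_some A : deg h A = #|cut [set v | Some v \in A]|.
Proof. by rewrite degE; apply: eq_card => e; rewrite inE crossing_some. Qed.

(** The extra vertex [None] serves as the fresh root. *)
Lemma thin_some : bridgeless G -> edge_cuts G 5 = set0 -> (#|edge_cuts G 3| <= 3)%N ->
  thin h S None.
Proof.
move=> br c5 c3; split.
- by move=> e; rewrite !inE.
- by rewrite !inE eqxx.
- move=> A _; rewrite deg_some; apply/negP=> c1; have /cards1P[e cE] := c1.
  by have := br e; rewrite bridgeE inE -cE c1 andbT imset_f.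
- move=> A _; rewrite deg_some; apply/negP=> d5.
  by have /setP /(_ (cut [set v | Some v \in A])) := c5; rewrite !inE d5 andbT imset_f.
apply: leq_trans c3; apply: subset_leq_card; apply/subsetP=> C.
rewrite !inE => /andP[/imsetP[A _ ->] ->]; rewrite andbT.
apply/imsetP; exists [set v | Some v \in A] => //.
by apply/setP=> e; rewrite inE crossing_some.
Qed.

Lemma flow3_some : flow3 h S -> flow3 D setT.
Proof.
case=> g sg g3; exists g => // v _; have := g3 (Some v); rewrite !inE => /(_ isT).
congr (is_true (_ %| _)%Z); apply: eq_bigr => e _.
by rewrite /incid !inE.
Qed.

Lemma net_arcs f v : net D f [set v] =
  \sum_(e in out_arcs D v) f e - \sum_(e in in_arcs D v) f e.
Proof.
rewrite /net [X in X - _]big_mkcond [X in _ - X]big_mkcond -sumrB.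
apply: eq_bigr => e _; rewrite /incid !inE.
by do 2!case: (_ == v); rewrite ?mulr0 ?subr0 ?subrr ?sub0r ?mulr1 ?mulrN1.
Qed.

End Orient.

Lemma has_orientation (G : mgraph) : exists D : edge G -> vertex G * vertex G, orientation D.
Proof.
have /fin_all_exists[D oD] : forall e : edge G, exists p, ends e = [set p.1; p.2].
  by move=> e; have /eqP/cards2P[u [v [_ uv]]] := card_ends e; exists (u, v).
by exists D.
Qed.

Local Close Scope ring_scope.
Unset Implicit Arguments.

Theorem theorem1p14 (G : mgraph) (G_bridgeless : bridgeless G)
  (no_5cut : edge_cuts G 5 = set0) (few_3cuts : #|edge_cuts G 3| <= 3) :
  nowhere_zero_3flow G.
Proof.
have [D oD] := has_orientation G.
have := thin_flow3 (thin_some oD G_bridgeless no_5cut few_3cuts).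
move/flow3_some => /integral_flow[f sf f0]; exists D, f; split=> // v.
by apply/eqP; rewrite -GRing.subr_eq0 -net_arcs f0.
Qed.
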